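(* Let $H$ be a Hilbert space, $\mu$ a probability measure on $H$, and $\mathcal{H}=L^2(H,\mu)$. Let $(P_t)_{t\ge 0}$ be a strongly continuous semigroup on $\mathcal{H}$ with infinitesimal generator $-N$, such that for some $\omega\in\mathbb{R}$ one has $|P_t\phi|_{\mathcal{H}}\le e^{\omega t}|\phi|_{\mathcal{H}}$ for all $t\ge 0$ and $\phi\in\mathcal{H}$. Let $g\in\mathcal{H}$. Assume that $P_t$ is positivity preserving (that is, $P_t\varphi\ge 0$ $\mu$-a.e. whenever $\varphi\ge 0$ $\mu$-a.e.) and that there is a constant $C$ such that $$|(N_\lambda g)^+|_{\mathcal{H}}\le C\qquad\forall \lambda\in(0,1/\omega).$$ Then the operator $N+\mathcal{N}_g$ with domain $D(N)\cap\mathcal{K}_g$ is $\omega$-$m$-accretive in $\mathcal{H}$.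
   Context: $\mathcal{K}_g=\{\phi\in\mathcal{H}:\ \phi\ge g\ \mu\text{-a.e.}\}$, a closed convex subset of $\mathcal{H}$. For $\phi\in\mathcal{K}_g$, the normal cone to $\mathcal{K}_g$ at $\phi$ is $\mathcal{N}_g(\phi)=\{z\in\mathcal{H}:\ \int_H z(\phi-\psi)\,d\mu\ge 0\ \ \forall\psi\in\mathcal{K}_g\}$; equivalently, $z\in\mathcal{H}$ belongs to $\mathcal{N}_g(\phi)$ iff, $\mu$-a.e., $z(x)=0$ where $\phi(x)>g(x)$ and $z(x)\le 0$ where $\phi(x)=g(x)$. A (possibly multivalued) operator $A:D(A)\subset\mathcal{H}\to\mathcal{H}$ is $m$-accretive (equivalently, maximal monotone) if $\langle y_1-y_2,x_1-x_2\rangle_{\mathcal{H}}\ge 0$ for all $y_i\in Ax_i$, $i=1,2$, and the range of $I+A$ is $\mathcal{H}$. $A$ is $\omega$-$m$-accretive if $\lambda I+A$ is $m$-accretive for all $\lambda>\omega$. The operator $N$ above is $\omega$-$m$-accretive. The Yosida approximation of $N$ is $N_\lambda u=\frac1\lambda\big(u-(I+\lambda N)^{-1}u\big)$, $u\in\mathcal{H}$, $0<\lambda<1/\omega$; if $\omega\le 0$ the interval $(0,1/\omega)$ is read as $(0,\infty)$. $u^+=\max(u,0)$. *)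

(* Defs.v *)
From HB Require Import structures.
From mathcomp Require Import all_boot all_order all_algebra.
From mathcomp Require Import all_classical all_reals all_analysis.
From mathcomp Require Import ess_sup_inf measurable_realfun.

Set Implicit Arguments.
Unset Strict Implicit.
Unset Printing Implicit Defensive.
Import Order.TTheory GRing.Theory Num.Theory.
Import numFieldNormedType.Exports.
Local Open Scope classical_set_scope.
Local Open Scope ring_scope.
Local Open Scope quotient_scope.

(* The library's LspaceType mu p1 is the bare type of a.e.-equivalence classes
   with finite Lp norm.  It is turned here into a normed module, with the
   operations computed on representatives and the norm given by Lnorm. *)
Section Lspace_normedModType.
Context d (T : measurableType d) (R : realType).
Variables (mu : {measure set T -> \bar R}) (p : \bar R) (p1 : (1 <= p)%E).

Local Notation Lp := (LspaceType mu p1).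
Local Notation Lf := (LfunType mu p1).
Local Notation mf := (@MeasurableFun.type _ _ T (measurableTypeR R)).

HB.instance Definition _ := gen_eqMixin Lp.
HB.instance Definition _ := gen_choiceMixin Lp.

Definition Lp_fun (u : Lp) : T -> R := repr (LebesgueSpace.sort u).

Lemma Lp_fun_Lfun (u : Lp) : Lp_fun u \in Lfun mu p.
Proof.
rewrite inE; apply/andP; split; rewrite inE/=.
  exact: (@measurable_funPT _ _ _ _ (repr (LebesgueSpace.sort u))).
exact: (@Lebesgue_finite _ _ _ _ _ p1 u).
Qed.

Definition Lp_repr (u : Lp) : Lf := Lfun_Sub p1 (Lp_fun_Lfun u).

Lemma eq_Lnorm_ae (f g : T -> R) :
  measurable_fun setT f -> measurable_fun setT g -> f = g %[ae mu] ->
  ('N[mu]_p[EFin \o f] = 'N[mu]_p[EFin \o g])%E.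
Proof.
move=> mf mg fg; rewrite unlock /Lnorm; case: p p1 => [r r1|_|//].
  have mabs (h : T -> R) : measurable_fun setT h ->
      measurable_fun setT (fun x => `|(EFin \o h) x| `^ r)%E.
    move=> mh; apply: (@measurableT_comp _ _ _ _ _ _ (fun x => x `^ r)%E) => //=.
      exact: measurable_poweR.
    by apply: measurableT_comp => //; exact: measurableT_comp.
  congr poweR; apply: ae_eq_integral => //; [exact: mabs|exact: mabs|].
  by apply: filterS fg => x /[apply] /= ->.
case: ifPn => // _; apply: eq_ess_sup.
by apply: filterS fg => x /(_ I) /= ->.
Qed.

Lemma mf_subproof (f : Lf) : measurable_fun setT (f : T -> measurableTypeR R).
Proof. by move=> mT Y mY; apply: (@measurable_funPT _ _ _ _ f mT Y). Qed.

Definition mfun_of_Lfun (f : Lf) : mf :=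
  MeasurableFun.Pack (MeasurableFun.Class
    (isMeasurableFun.Build _ _ _ _ _ (mf_subproof f))).

Definition mfun_class (f : Lf) : {mfun_ mu, T >-> measurableTypeR R} :=
  \pi_({mfun_ mu, T >-> measurableTypeR R}) (mfun_of_Lfun f).

Lemma mfun_class_ae (f : Lf) : (repr (mfun_class f) : T -> R) = f %[ae mu].
Proof.
have /eqP := @reprK _ {mfun_ mu, T >-> measurableTypeR R} (mfun_class f).
by rewrite eqmodE => /asboolP.
Qed.

Lemma mfun_class_finite (f : Lf) : finite_norm mu p (mfun_class f).
Proof.
rewrite /finite_norm -[ltLHS](_ : 'N[mu]_p[EFin \o f] = _)%E.
  exact: Lfunction_finite.
apply: eq_Lnorm_ae; last exact/ae_eq_sym/mfun_class_ae.
  exact: measurable_funPT.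
exact: (@measurable_funPT _ _ _ _ (repr (mfun_class f))).
Qed.

Definition Lp_class (f : Lf) : Lp :=
  LebesgueSpace.Pack (LebesgueSpace.Class
    (isFinLebesgue.Build _ _ _ mu p p1 (mfun_class f) (mfun_class_finite f))).

Lemma Lp_classK (f : Lf) : Lp_repr (Lp_class f) = f %[ae mu].
Proof. exact: mfun_class_ae. Qed.

Lemma Lp_eqP (u v : Lp) : u = v <-> Lp_repr u = Lp_repr v %[ae mu].
Proof.
split=> [->|uv]; first exact: ae_eq_refl.
have : LebesgueSpace.sort u = LebesgueSpace.sort v.
  rewrite -[LHS]reprK -[RHS]reprK; apply/eqP; rewrite eqmodE.
  exact/asboolP.
move: u v {uv} => [u [[uf]]] [v [[vf]]] /= uv; subst v.
by rewrite (Prop_irrelevance uf vf).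
Qed.

Lemma Lp_class_eq (f g : Lf) : f = g %[ae mu] -> Lp_class f = Lp_class g.
Proof.
move=> fg; apply/Lp_eqP; apply: ae_eq_trans (Lp_classK f) _.
exact: ae_eq_trans fg (ae_eq_sym (Lp_classK g)).
Qed.

Lemma Lp_reprK : cancel Lp_repr Lp_class.
Proof. by move=> u; apply/Lp_eqP; exact: Lp_classK. Qed.

Lemma Lp_ind (P : Lp -> Prop) : (forall f, P (Lp_class f)) -> forall u, P u.
Proof. by move=> Pf u; rewrite -(Lp_reprK u). Qed.

Definition Lp_zero : Lp := Lp_class 0.
Definition Lp_opp (u : Lp) : Lp := Lp_class (- Lp_repr u).
Definition Lp_add (u v : Lp) : Lp := Lp_class (Lp_repr u + Lp_repr v).
Definition Lp_scale (a : R) (u : Lp) : Lp := Lp_class (a *: Lp_repr u).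
Definition Lp_norm (u : Lp) : R := fine ('N[mu]_p[EFin \o Lp_repr u]).

Lemma Lp_oppE (f : Lf) : Lp_opp (Lp_class f) = Lp_class (- f).
Proof.
apply: Lp_class_eq; apply: filterS (Lp_classK f) => x /(_ I) fx _.
by change (- Lp_repr (Lp_class f) x = - f x); rewrite fx.
Qed.

Lemma Lp_addE (f g : Lf) : Lp_add (Lp_class f) (Lp_class g) = Lp_class (f + g).
Proof.
apply: Lp_class_eq; apply: filterS2 (Lp_classK f) (Lp_classK g).
move=> x /(_ I) fx /(_ I) gx _.
by change (Lp_repr (Lp_class f) x + Lp_repr (Lp_class g) x = f x + g x);
  rewrite fx gx.
Qed.

Lemma Lp_scaleE (a : R) (f : Lf) : Lp_scale a (Lp_class f) = Lp_class (a *: f).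
Proof.
apply: Lp_class_eq; apply: filterS (Lp_classK f) => x /(_ I) fx _.
by change (a * Lp_repr (Lp_class f) x = a * f x); rewrite fx.
Qed.

Lemma Lp_normE (f : Lf) : Lp_norm (Lp_class f) = fine ('N[mu]_p[EFin \o f]).
Proof.
congr fine; apply: eq_Lnorm_ae; last exact: Lp_classK.
  exact: measurable_funPT.
exact: measurable_funPT.
Qed.

Lemma Lp_addA : associative Lp_add.
Proof.
elim/Lp_ind=> f; elim/Lp_ind=> g; elim/Lp_ind=> h.
by rewrite !Lp_addE addrA.
Qed.

Lemma Lp_addC : commutative Lp_add.
Proof. by elim/Lp_ind=> f; elim/Lp_ind=> g; rewrite !Lp_addE addrC. Qed.

Lemma Lp_add0 : left_id Lp_zero Lp_add.
Proof. by elim/Lp_ind=> f; rewrite Lp_addE add0r. Qed.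

Lemma Lp_addN : left_inverse Lp_zero Lp_opp Lp_add.
Proof. by elim/Lp_ind=> f; rewrite Lp_oppE Lp_addE addNr. Qed.

HB.instance Definition _ :=
  GRing.isZmodule.Build Lp Lp_addA Lp_addC Lp_add0 Lp_addN.

Lemma Lp_scaleA a b u : Lp_scale a (Lp_scale b u) = Lp_scale (a * b) u.
Proof. by elim/Lp_ind: u => f; rewrite !Lp_scaleE scalerA. Qed.

Lemma Lp_scale1 : left_id 1 Lp_scale.
Proof. by elim/Lp_ind=> f; rewrite Lp_scaleE scale1r. Qed.

Lemma Lp_scaleDr : right_distributive Lp_scale +%R.
Proof.
move=> a; elim/Lp_ind=> f; elim/Lp_ind=> g.
by rewrite [X in Lp_scale _ X]Lp_addE !Lp_scaleE [RHS]Lp_addE scalerDr.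
Qed.

Lemma Lp_scaleDl u : {morph Lp_scale^~ u : a b / a + b}.
Proof.
move=> a b; elim/Lp_ind: u => f.
by rewrite !Lp_scaleE [RHS]Lp_addE scalerDl.
Qed.

HB.instance Definition _ := GRing.Zmodule_isLmodule.Build R Lp
  Lp_scaleA Lp_scale1 Lp_scaleDr Lp_scaleDl.

Lemma Lp_normD (u v : Lp) : Lp_norm (u + v) <= Lp_norm u + Lp_norm v.
Proof.
elim/Lp_ind: u => f; elim/Lp_ind: v => g.
by rewrite [X in Lp_norm X <= _]Lp_addE !Lp_normE ler_LnormD.
Qed.

Lemma Lp_normZ (a : R) (u : Lp) : Lp_norm (a *: u) = `|a| * Lp_norm u.
Proof.
elim/Lp_ind: u => f; rewrite [X in Lp_norm X = _]Lp_scaleE !Lp_normE.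
by apply: EFin_inj; rewrite EFinM !finite_norm_fine -LnormZ.
Qed.

Lemma Lp_norm_eq0 (u : Lp) : Lp_norm u = 0 -> u = 0.
Proof.
elim/Lp_ind: u => f; rewrite Lp_normE => /fine_Lnormr_eq0 f0.
exact: Lp_class_eq.
Qed.

HB.instance Definition _ := Lmodule_isNormed.Build R Lp
  Lp_normD Lp_normZ Lp_norm_eq0.

Lemma Lp_repr0 : Lp_repr 0 = cst 0 %[ae mu].
Proof. exact: Lp_classK. Qed.

Lemma Lp_reprN (u : Lp) : Lp_repr (- u) = \- Lp_repr u %[ae mu].
Proof. exact: Lp_classK. Qed.

Lemma Lp_reprD (u v : Lp) : Lp_repr (u + v) = Lp_repr u \+ Lp_repr v %[ae mu].
Proof. exact: Lp_classK. Qed.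

Lemma Lp_reprZ (a : R) (u : Lp) : Lp_repr (a *: u) = a \*o Lp_repr u %[ae mu].
Proof. exact: Lp_classK. Qed.

Lemma Lp_norm_def (u : Lp) : `|u|%:E = ('N[mu]_p[EFin \o Lp_repr u])%E.
Proof. exact: finite_norm_fine. Qed.

End Lspace_normedModType.

Section L2.
Context d (T : measurableType d) (R : realType).
Variable mu : {measure set T -> \bar R}.
Local Notation L2 := (LspaceType2 mu).

Definition L2dot (u v : L2) : R := (\int[mu]_x (Lp_repr u x * Lp_repr v x))%R.

Lemma L2_integrableM (u v : L2) :
  mu.-integrable setT (EFin \o (fun x => Lp_repr u x * Lp_repr v x)).
Proof. by apply/Lfun1_integrable; apply: Lfun2_mul_Lfun1; exact: LfunP. Qed.

Lemma L2dotC u v : L2dot u v = L2dot v u.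
Proof. by apply: eq_Rintegral => x _; rewrite mulrC. Qed.

Lemma L2dot_linearl (w : L2) : linear_for *%R (L2dot^~ w : L2 -> R).
Proof.
move=> a u v; have iM := L2_integrableM.
have iZ : mu.-integrable setT
    (EFin \o (fun x => a * (Lp_repr u x * Lp_repr w x))).
  rewrite (_ : _ \o _ = fun x =>
    (a%:E * (EFin \o (fun x => Lp_repr u x * Lp_repr w x)%R) x)%E)//.
  exact: integrableZl.
rewrite /L2dot -RintegralZl// -RintegralD//.
congr fine; apply: ae_eq_integral => //.
- exact: measurable_int (iM _ _).
- by apply: measurable_int (integrableD _ iZ (iM v w)).
- apply: filterS2 (Lp_reprD (a *: u) v) (Lp_reprZ a u).
  by move=> x /(_ I) /= xD /(_ I) /= xZ _; rewrite xD xZ mulrDl mulrA.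
Qed.

Lemma L2dot_linearr (w : L2) : linear_for *%R (L2dot w : L2 -> R).
Proof.
by move=> a u v; rewrite L2dotC L2dot_linearl !(L2dotC w).
Qed.

Lemma L2dot_norm (u : L2) : L2dot u u = `|u| ^+ 2.
Proof.
apply: EFin_inj; rewrite fineK; last first.
  by apply: integrable_fin_num => //; exact: L2_integrableM.
rewrite -powR_mulrn// -poweR_EFin Lp_norm_def poweR_Lnorm//.
apply: eq_integral => x _; rewrite abse_EFin poweR_EFin powR_mulrn//.
by rewrite -normrX ger0_norm ?sqr_ge0// expr2.
Qed.

Lemma L2dot_gt0 (u : L2) : u != 0 -> 0 < L2dot u u.
Proof. by move=> u0; rewrite L2dot_norm exprn_gt0// normr_gt0. Qed.

Lemma L2dot_hermitian (u v : L2) :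
  L2dot u v = (-1) ^+ false * idfun (L2dot v u).
Proof. by rewrite expr0 mul1r L2dotC. Qed.

HB.instance Definition _ := bilinear_isBilinear.Build R L2 L2 R
  *%R (idfun \; *%R) L2dot (L2dot_linearl, L2dot_linearr).
HB.instance Definition _ := isHermitianSesquilinear.Build R L2 false idfun
  L2dot L2dot_hermitian.
HB.instance Definition _ := isDotProduct.Build R L2 L2dot L2dot_gt0.

Lemma L2pos_Lfun (u : L2) : (fun x => Num.max (Lp_repr u x) 0) \in Lfun mu 2%:E.
Proof.
have nu : Num.norm \o Lp_repr u \in Lfun mu 2%:E.
  have := LfunP (Lp_repr u).
  rewrite !inE => /andP[/[!inE]/= mu' fu]; apply/andP; split; rewrite inE/=.
    exact: measurableT_comp.
  rewrite /finite_norm.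
  under [X in ('N[_]__[X])%E]eq_fun => x do rewrite /= -abse_EFin.
  by rewrite Lnorm_abse.
have -> : (fun x => Num.max (Lp_repr u x) 0) =
    2^-1 *: ((Lp_repr u : T -> R) + (Num.norm \o Lp_repr u : T -> R)).
  apply/funext => x.
  change (Num.max (Lp_repr u x) 0 = 2^-1 * (Lp_repr u x + `|Lp_repr u x|)).
  move: (Lp_repr u x) => y; have [y0|y0] := ltP y 0.
    by rewrite ltr0_norm// subrr mulr0.
  by rewrite ger0_norm// -mulr2n -[y *+ 2]mulr_natl mulKf// pnatr_eq0.
have [L0 LZD] := Lfun_submod_closed mu (lee1n 2).
have uL := LfunP (Lp_repr u).
have := LZD 2^-1 _ 0 (LZD 1 _ _ uL nu) L0.
by rewrite scale1r addr0.
Qed.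

Definition L2pos (u : L2) : L2 := Lp_class (Lfun_Sub (lee1n 2) (L2pos_Lfun u)).

Lemma L2posE (u : L2) :
  Lp_repr (L2pos u) = (fun x => Num.max (Lp_repr u x) 0) %[ae mu].
Proof. exact: Lp_classK. Qed.

End L2.

(* A : operator V is a multivalued operator: A x is the set of its values at x,
   empty when x is outside the domain. *)
Definition operator (V : Type) := V -> set V.

Section operators.
Context {R : realType} {V : normedModType R}.
Implicit Types A B : operator V.

Definition op_dom A : set V := [set x | A x !=set0].
Definition op_ran A : set V := [set y | exists x, A x y].
Definition op_id : operator V := fun x => [set x].
Definition op_add A B : operator V :=
  fun x => [set y + z | y in A x & z in B x].
Definition op_scale (a : R) A : operator V := fun x => [set a *: y | y in A x].
Definition op_inv A : operator V := fun y => [set x | A x y].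

Definition m_accretive (ip : {dot V for idfun}) A :=
  (forall x1 x2 y1 y2, A x1 y1 -> A x2 y2 -> 0 <= ip (y1 - y2) (x1 - x2)) /\
  op_ran (op_add op_id A) = setT.

Definition omega_m_accretive (ip : {dot V for idfun}) (omega : R) A :=
  forall lam, omega < lam -> m_accretive ip (op_add (op_scale lam op_id) A).

(* (I + lam A)^-1, as a function: its value at u where it has one (it is unique
   when A is omega-m-accretive and lam is in yosida_range omega), 0 otherwise. *)
Definition resolvent A (lam : R) (u : V) : V :=
  xget 0 (op_inv (op_add op_id (op_scale lam A)) u).

Definition yosida A (lam : R) (u : V) : V := lam^-1 *: (u - resolvent A lam u).

(* the interval ]0, 1/omega[, read as ]0, +oo[ when omega <= 0 *)
Definition yosida_range (omega : R) : set R :=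
  [set lam | 0 < lam /\ (0 < omega -> lam < omega^-1)].

(* Only the values of P at nonnegative times are constrained. *)
Definition C0_semigroup (P : R -> {linear V -> V}) :=
  [/\ forall t, 0 <= t -> continuous (P t),
      forall u, P 0 u = u,
      forall s t u, 0 <= s -> 0 <= t -> P (s + t) u = P s (P t u)
    & forall u, P t u @[t --> 0^'+] --> u].

Definition generator (P : R -> {linear V -> V}) : operator V :=
  fun u => [set z | h^-1 *: (P h u - u) @[h --> 0^'+] --> z].

Definition normal_cone (ip : {dot V for idfun}) (K : set V) : operator V :=
  fun u => [set z | K u /\ forall v, K v -> 0 <= ip z (u - v)].

Definition induces_norm (ip : {dot V for idfun}) :=
  forall x, ip x x = `|x| ^+ 2.

End operators.

Section obstacle.
Context d (T : measurableType d) (R : realType).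
Variable mu : {measure set T -> \bar R}.

Definition L2ip : {dot LspaceType2 mu for idfun} := @L2dot d T R mu.

Definition L2_nonneg (u : LspaceType2 mu) := \forall x \ae mu, 0 <= Lp_repr u x.

Definition positivity_preserving
    (P : R -> {linear LspaceType2 mu -> LspaceType2 mu}) :=
  forall t u, 0 <= t -> L2_nonneg u -> L2_nonneg (P t u).

Definition K_above (g : LspaceType2 mu) : set (LspaceType2 mu) :=
  [set u | \forall x \ae mu, Lp_repr g x <= Lp_repr u x].

End obstacle.

(* Main.v *)
(** Let [B = N + omega], the negative generator of the contraction semigroup
   [Q t = exp (- omega t) P t].  The resolvents of [B] are limits of the solutions
   of [b v + (v - Q h v) / h = f] along [h = 2^-n], a Cauchy sequence because
   the difference quotient at a multiple of [h] averages the one at [h]; they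
   are therefore linear, nonexpansive (up to [b]) and positive.

   To solve [a u + B u + z = f] with [z] in the normal cone, replace [B] by its
   Yosida approximation [u |-> b (u - r)], [r] the resolvent of [b u].  The
   approximate problem reads [u = max g ((f + b r) / (a + b))], a fixed point of a
   contraction.  As [u >= g] and resolvents are positive, its multiplier is
   bounded by the positive part of [a g - f + b (g - r_g)], [r_g] the resolvent of
   [b g], which the hypothesis on [g] keeps bounded as [b] grows.  Monotonicity
   then makes the solutions Cauchy, and the bounded multipliers have a weak
   limit, obtained as a common point of nested closed convex sets. *)

Require Import Defs.
From HB Require Import structures.
From mathcomp Require Import all_boot all_order all_algebra.
From mathcomp Require Import all_classical all_reals all_analysis.
From mathcomp Require Import measurable_realfun ring lra.
Set Implicit Arguments.
Unset Strict Implicit.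
Unset Printing Implicit Defensive.
Import Order.TTheory GRing.Theory Num.Theory.
Import numFieldNormedType.Exports.
Local Open Scope classical_set_scope.
Local Open Scope ring_scope.

(** * Hilbert space preliminaries *)

Section Sequences.
Context {R : realType}.

Lemma cvgn_cauchy (V : completeNormedModType R) (u : V^nat) :
  (forall e, 0 < e -> exists N : nat, forall n m : nat, (N <= n)%N -> (n <= m)%N ->
    `|u n - u m| <= e) -> cvgn u.
Proof.
move=> hu; apply/cauchy_cvgP/cauchy_exP => e e0.
have [N hN] := hu _ (divr_gt0 e0 (ltr0Sn R 1)).
exists (u N), N => // n /= Nn; rewrite -ball_normE /=.
by apply: le_lt_trans (hN _ _ (leqnn N) Nn) _; lra.
Qed.

Lemma cvgn_cauchy_sqr (V : completeNormedModType R) (u : V^nat) (eps : R^nat) :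
  eps @ \oo --> 0 ->
  (forall n m : nat, (n <= m)%N -> `|u n - u m| ^+ 2 <= eps n) -> cvgn u.
Proof.
move=> eps0 hu; apply: cvgn_cauchy => e e0.
have /cvgr_le/(_ (e ^+ 2) (exprn_gt0 _ e0))[N _ hN] := eps0.
exists N => n m Nn nm; rewrite -(@ler_pXn2r _ 2%N)// ?nnegrE ?(ltW e0)//.
exact: le_trans (hu _ _ nm) (hN _ Nn).
Qed.

Lemma cvgn0_le (V : normedModType R) (u : V^nat) (l : V) (eps : R^nat) :
  eps @ \oo --> 0 -> (forall n, `|l - u n| <= eps n) -> u @ \oo --> l.
Proof.
move=> eps0 hu; apply/cvgrPdist_le => e e0.
apply: filterS (cvgr_le _ eps0 _ e0) => n; exact: le_trans.
Qed.

End Sequences.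

Section InnerProduct.
Context {R : realType} {V : normedModType R} (ip : {dot V for idfun}).
Hypothesis hip : induces_norm ip.

Lemma ipC u v : ip u v = ip v u.
Proof. by rewrite hermC expr0 mul1r. Qed.

Lemma ipZl a u v : ip (a *: u) v = a * ip u v.
Proof. exact: linearZl_LR. Qed.

Lemma ipZr a u v : ip u (a *: v) = a * ip u v.
Proof. exact: linearZr_LR. Qed.

Lemma ipDl u v w : ip (u + v) w = ip u w + ip v w.
Proof. exact: linearDl. Qed.

Lemma ipNl u v : ip (- u) v = - ip u v.
Proof. exact: linearNl. Qed.

Lemma ip0l v : ip 0 v = 0.
Proof. exact: linear0l. Qed.

Lemma ipDr u v w : ip w (u + v) = ip w u + ip w v.
Proof. exact: linearDr. Qed.

Lemma ipNr u v : ip u (- v) = - ip u v.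
Proof. exact: linearNr. Qed.

Definition ipBE := (ipDl, ipNl, ipDr, ipNr).

Definition ipE := (ipDl, ipNl, ipZl, ip0l).

Lemma ip_inj u v : (forall w, ip u w = ip v w) -> u = v.
Proof.
move=> uv; apply/eqP; rewrite -subr_eq0 -normr_eq0 -sqrf_eq0 -hip.
by rewrite ipDl ipNl uv subrr.
Qed.

Lemma ip_normD u v : `|u + v| ^+ 2 = `|u| ^+ 2 + 2 * ip u v + `|v| ^+ 2.
Proof. rewrite -!hip linearDl !linearDr /= (ipC v u); ring. Qed.

Lemma ip_normB u v : `|u - v| ^+ 2 = `|u| ^+ 2 - 2 * ip u v + `|v| ^+ 2.
Proof. rewrite ip_normD linearNr normrN; ring. Qed.

Lemma ip_le u v : ip u v <= `|u| * `|v|.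
Proof.
have [->|u0] := eqVneq u 0; first by rewrite linear0l normr0 mul0r.
have [->|v0] := eqVneq v 0; first by rewrite linear0r normr0 mulr0.
have uv0 : 0 < `|u| * `|v| by rewrite mulr_gt0 ?normr_gt0.
(* Nonnegativity of this square is Cauchy-Schwarz multiplied by [2 |u| |v|]. *)
have := sqr_ge0 (`| `|v| *: u - `|u| *: v|).
rewrite ip_normB !normrZ !normr_id ipZl ipZr => h.
rewrite -(ler_pM2l uv0).
lra.
Qed.

Lemma ip_ge u v : - (`|u| * `|v|) <= ip u v.
Proof. by have := ip_le (- u) v; rewrite linearNl normrN; lra. Qed.

Lemma cvg_ipl (T : Type) (F : set_system T) {FF : Filter F} (f : T -> V) u v :
  f @ F --> u -> (fun x => ip (f x) v) @ F --> ip u v.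
Proof.
move=> fu; apply/cvgrPdist_le => e e0.
have v0 : 0 < `|v| + 1 by rewrite ltr_wpDl.
have /cvgr_dist_le/(_ _ (divr_gt0 e0 v0)) := fu.
apply: filterS => x; rewrite ler_pdivlMr// => h.
rewrite -linearBl /=.
have le1 : `|u - f x| * `|v| <= e.
  apply: le_trans h; rewrite ler_wpM2l// ler_wpDr//.
rewrite ler_norml (le_trans _ (ip_ge _ _)) ?lerN2//=.
exact: le_trans (ip_le _ _) le1.
Qed.

End InnerProduct.

(* Pairing with an arbitrary vector reduces an identity between linear
   combinations to a ring identity. *)
Ltac vring hip := apply: (ip_inj hip) => ?; rewrite ?ipE; ring.
Ltac vfield hip := apply: (ip_inj hip) => ?; rewrite ?ipE; field.

Section NestedConvex.
Context {R : realType} {V : completeNormedModType R} (ip : {dot V for idfun}).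
Hypothesis hip : induces_norm ip.

(* The near-minimizers of the norm over the [C n] form a Cauchy sequence, by the
   parallelogram identity. *)
Lemma nested_convex_nonempty (C : (set V)^nat) (M : R) :
  (forall n, C n !=set0) -> (forall n m : nat, (n <= m)%N -> C m `<=` C n) ->
  (forall n, closed (C n)) ->
  (forall n u v, C n u -> C n v -> C n (2^-1 *: (u + v))) ->
  (forall n u, C n u -> `|u| <= M) -> exists u, forall n, C n u.
Proof.
move=> C0 Cle Ccl Cmid CM.
pose S n := [set `|u| ^+ 2 | u in C n].
have Sinf n : has_inf (S n).
  split; first by have [u Cu] := C0 n; exists (`|u| ^+ 2); exists u.
  by exists 0 => _ [u _ <-]; exact: sqr_ge0.
pose dd n := inf (S n).
have dle n u : C n u -> dd n <= `|u| ^+ 2.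
  by move=> Cu; apply: ge_inf; [case: (Sinf n)|exists u].
have dmono : {homo dd : n m / (n <= m)%N >-> n <= m}.
  move=> n m nm; apply: lb_le_inf; first by case: (Sinf m).
  by move=> _ [u Cu <-]; apply: dle; exact: Cle nm _ Cu.
have dM n : dd n <= M ^+ 2.
  have [u Cu] := C0 n; apply: le_trans (dle _ _ Cu) _.
  by rewrite lerXn2r ?nnegrE ?CM ?(le_trans _ (CM _ _ Cu)).
have /cvg_ex[l dl] : cvgn dd.
  apply: nondecreasing_is_cvgn => //.
  by exists (M ^+ 2) => _ [n _ <-].
have dlel n : dd n <= l.
  rewrite -(cvg_lim _ dl)//; apply: nondecreasing_cvgn_le => //.
  by apply/cvg_ex; exists l.
have /choice[x hx] n : exists u, C n u /\ `|u| ^+ 2 <= dd n + n.+1%:R^-1.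
  have n0 : 0 < n.+1%:R^-1 :> R by rewrite invr_gt0.
  have [_ [u Cu <-] lu] := inf_adherent n0 (Sinf n).
  by exists u; split => //; exact: ltW.
have /cvg_ex[u xu] : cvgn x.
  (* The midpoint of [x n] and [x m] lies in [C n], so its squared norm is at least [dd n], while
     [dd m <= l]. What remains is [2 (l - dd n)] and twice each of the two slacks. *)
  apply: (@cvgn_cauchy_sqr _ _ _ (fun n => 2 * (l - dd n) + 4 * n.+1%:R^-1)).
    rewrite (_ : 0 = 2 * (l - l) + 4 * 0 :> R); last by rewrite subrr; ring.
    apply: cvgD; apply: cvgMr; last exact: cvg_harmonic.
    by apply: cvgB => //; exact: cvg_cst.
  move=> n m nm.
  have [Cn xn] := hx n; have [Cm xm] := hx m.
  have mid := dle _ _ (Cmid n _ _ Cn (Cle _ _ nm _ Cm)).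
  have inv : m.+1%:R^-1 <= n.+1%:R^-1 :> R.
    by rewrite lef_pV2 ?posrE// ler_nat ltnS.
  have dm := dlel m; rewrite normrZ gtr0_norm ?invr_gt0// exprMn in mid.
  rewrite (ip_normB hip); rewrite (ip_normD hip) in mid.
  move: inv mid xn xm dm; move: (n.+1%:R^-1) (m.+1%:R^-1) (dd n) (dd m).
  by move=> a b c e; rewrite expr2; lra.
exists u => n; apply: (@closed_cvg _ _ \oo _ x (C n)) => //.
by exists n => // m /= nm; apply: Cle nm _ _; case: (hx m).
Qed.

End NestedConvex.

(** * Resolvents of a contraction semigroup *)

Lemma contraction_fixpoint (R : realType) (V : completeNormedModType R)
    (K : set V) (F : V -> V) (q : R) :
  0 <= q -> q < 1 -> closed K -> K !=set0 -> (forall x, K x -> K (F x)) ->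
  (forall x y, `|F x - F y| <= q * `|x - y|) -> exists2 x, K x & F x = x.
Proof.
move=> q0 q1 Kcl K0 KF Fq.
have [|//|//|p Kp pF] := @banach_fixed_point _ _ K (mkfun KF).
  by exists (NngNum q0); split => // -[x y] _; exact: Fq.
by exists p.
Qed.

Section ContractionSemigroup.
Context {R : realType} {V : completeNormedModType R} (ip : {dot V for idfun}).
Hypothesis hip : induces_norm ip.
Variable Q : R -> {linear V -> V}.
Hypothesis hQ : C0_semigroup Q.
Hypothesis Qle : forall t u, 0 <= t -> `|Q t u| <= `|u|.

Lemma semigroup_near0 u e : 0 < e ->
  exists2 T, 0 < T & forall s, 0 <= s -> s <= T -> `|Q s u - u| <= e.
Proof.
move=> e0; have [_ Q0 _ Qc] := hQ.
have /cvgrPdist_le/(_ _ e0)[T /= T0 hT] := Qc u.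
exists (T / 2); first by rewrite divr_gt0.
move=> s; rewrite le_eqVlt => /predU1P[<- _|s0 sT].
  by rewrite Q0 subrr normr0 ltW.
rewrite distrC; apply: hT => //=.
by rewrite sub0r normrN gtr0_norm//; lra.
Qed.

Lemma semigroup_telescope h v (m : nat) : 0 <= h ->
  v - Q (m%:R * h) v = \sum_(k < m) Q (k%:R * h) (v - Q h v).
Proof.
move=> h0; have [_ Q0 QD _] := hQ.
elim: m => [|m IH]; first by rewrite mul0r Q0 subrr big_ord0.
rewrite big_ord_recr /= -IH -natr1 mulrDl mul1r QD ?mulr_ge0// linearB.
by rewrite addrA subrK.
Qed.

Section Euler.
Variables (b : R) (f : V).
Hypothesis b0 : 0 < b.

(* [euler h v] is the resolvent equation [b v + (v - Q h v) / h = f] of the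
   difference quotient of [Q], cleared of denominators. *)
Definition euler (h : R) (v : V) := (1 + b * h) *: v = h *: f + Q h v.

(** A solution is a fixed point of a contraction of ratio [1 / (1 + b h)]. Carrying a closed cone
    [K] through the construction yields existence and positivity together. *)
Lemma euler_exists (K : set V) h : 0 < h -> closed K -> K f ->
  (forall u v, K u -> K v -> K (u + v)) ->
  (forall a u, 0 <= a -> K u -> K (a *: u)) ->
  (forall u, K u -> K (Q h u)) -> exists2 v, K v & euler h v.
Proof.
move=> h0 Kcl Kf KD KZ KQ.
have p0 : 0 < 1 + b * h by rewrite addr_gt0// mulr_gt0.
pose F v := (1 + b * h)^-1 *: (h *: f + Q h v).
have q1 : (1 + b * h)^-1 < 1 by rewrite invf_lt1// ltrDl mulr_gt0.
have [||||v Kv Fv] := @contraction_fixpoint R V K F _ _ q1 Kcl.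
- by rewrite invr_ge0 ltW.
- by exists f.
- move=> x Kx; apply: (KZ); first by rewrite invr_ge0 ltW.
  by apply: KD; [apply: KZ => //; exact: ltW|exact: KQ].
- move=> x y; rewrite /F -scalerBr opprD addrACA subrr add0r -linearB.
  rewrite normrZ gtr0_norm ?invr_gt0// ler_wpM2l ?invr_ge0 ?(ltW p0)//.
  exact/Qle/ltW.
by exists v => //; rewrite /euler -[in LHS]Fv scalerA divff ?gt_eqF// scale1r.
Qed.

(** The datum [p] is free: it is [f] for a solution, and the residual for the difference of
    solutions with two step sizes. *)
Lemma euler_le h w p : 0 < h -> (1 + b * h) *: w = h *: p + Q h w ->
  b * `|w| <= `|p|.
Proof.
move=> h0 hw.
have p0 : 0 < 1 + b * h by rewrite addr_gt0// mulr_gt0.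
have := congr1 Num.norm hw; rewrite normrZ gtr0_norm// => hn.
have := ler_normD (h *: p) (Q h w); rewrite -hn normrZ gtr0_norm// => hl.
have := Qle w (ltW h0) => hq.
by rewrite -(ler_pM2l h0); lra.
Qed.

(** Since [v - Q h v = h (f - b v)], telescoping writes [v - Q (m h) v] as [h] times the sum of the
    [Q (k h) (f - b v)], so a bound on each summand passes to their average. *)
Lemma euler_drift h v g e (m : nat) : 0 <= h -> euler h v ->
  (forall k, (k < m)%N -> `|Q (k%:R * h) (f - b *: v) - g| <= e) ->
  `|v - Q (m%:R * h) v - (m%:R * h) *: g| <= m%:R * h * e.
Proof.
move=> h0 hv he.
have -> : v - Q (m%:R * h) v - (m%:R * h) *: g =
    h *: \sum_(k < m) (Q (k%:R * h) (f - b *: v) - g).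
  have vQ : v - Q h v = h *: (f - b *: v).
    rewrite (_ : Q h v = (1 + b * h) *: v - h *: f); first by vring hip.
    by rewrite hv; vring hip.
  rewrite semigroup_telescope// vQ sumrB [RHS]scalerBr sumr_const card_ord.
  rewrite -[g *+ m]scaler_nat [h *: (_ *: g)]scalerA [h * _]mulrC.
  congr (_ - _).
  by rewrite scaler_sumr; apply: eq_bigr => k _; rewrite linearZ.
rewrite normrZ ger0_norm// [in leRHS]mulrAC mulrC ler_wpM2r//.
apply: le_trans (ler_norm_sum _ _ _) _.
apply: le_trans (ler_sum _ (fun (k : 'I_m) _ => he k (ltn_ord k))) _.
by rewrite sumr_const card_ord mulr_natl.
Qed.

(** The solution for the step [h] almost solves the equation for the step [t = m h]: its residual is
    [r / t], of norm at most [e + 2 b t |f|]. Stability, [euler_le], then compares it with [w]. *)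
Lemma euler_dist h v w (m : nat) e : 0 < h -> (0 < m)%N ->
  euler h v -> euler (m%:R * h) w ->
  (forall s, 0 <= s -> s <= m%:R * h -> `|Q s f - f| <= e) ->
  b * `|v - w| <= e + b * (m%:R * h * (2 * `|f|)).
Proof.
move=> h0 m0 hv hw he; set t := m%:R * h.
have t0 : 0 < t by rewrite mulr_gt0 ?ltr0n.
set g := f - b *: v.
have gle : `|g| <= 2 * `|f|.
  have := euler_le h0 hv; rewrite /g => vf.
  have := ler_normB f (b *: v); rewrite normrZ (gtr0_norm b0); lra.
(* A crude drift estimate centred at 0 bounds [Q (k h) v - v]; it feeds the finer estimate centred
   at [g]. *)
have vle k : (k <= m)%N -> `|Q (k%:R * h) v - v| <= t * (2 * `|f|).
  move=> km; have kh0 : 0 <= k%:R * h by rewrite mulr_ge0 ?(ltW h0).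
  have := @euler_drift h v 0 (2 * `|f|) k (ltW h0) hv.
  rewrite scaler0 subr0 distrC => /(_ _)/le_trans; apply.
    move=> j _; rewrite subr0; apply: le_trans gle.
    by apply: Qle; rewrite mulr_ge0// ltW.
  by rewrite ler_wpM2r// ?mulr_ge0// ler_wpM2r ?ler_nat// ltW.
have := @euler_drift h v g (e + b * (t * (2 * `|f|))) m (ltW h0) hv.
rewrite -/t => /(_ _) hd.
have {}hd : `|v - Q t v - t *: g| <= t * (e + b * (t * (2 * `|f|))).
  apply: hd => k km; rewrite -/g /g linearB linearZ /=.
  have -> : Q (k%:R * h) f - b *: Q (k%:R * h) v - (f - b *: v) =
    (Q (k%:R * h) f - f) - b *: (Q (k%:R * h) v - v) by vring hip.
  apply: le_trans (ler_normB _ _) _; rewrite lerD//.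
    apply: he; first by rewrite mulr_ge0// ltW.
    by rewrite ler_wpM2r ?(ltW h0)// ler_nat ltnW.
  by rewrite normrZ gtr0_norm// ler_wpM2l ?(ltW b0)// vle// ltnW.
set r := v - Q t v - t *: g in hd.
have : (1 + b * t) *: (v - w) = t *: (t^-1 *: r) + Q t (v - w).
  have tn0 : t != 0 by rewrite gt_eqF.
  by rewrite scalerBr hw [Q t (v - w)]linearB /r /g -/t; vfield hip.
move/(euler_le t0) => h1; apply: le_trans h1 _.
by rewrite normrZ gtr0_norm ?invr_gt0// ler_pdivrMl.
Qed.

End Euler.

(** With [B] minus the generator, the conclusion reads [b v + B v = f]. Taking [K] to be the whole
    space gives resolvents of arbitrary data; taking it to be the positive cone gives their
    positivity. *)
Lemma resolvent_exists (K : set V) (b : R) (f : V) : 0 < b -> closed K -> K f ->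
  (forall u v, K u -> K v -> K (u + v)) ->
  (forall a u, 0 <= a -> K u -> K (a *: u)) ->
  (forall t u, 0 <= t -> K u -> K (Q t u)) ->
  exists2 v, K v & generator Q v (b *: v - f).
Proof.
move=> b0 Kcl Kf KD KZ KQ; have [_ Q0 QD _] := hQ.
(* Dyadic steps make each [h n] an integer multiple of every later one, as [euler_dist] requires. *)
pose h (n : nat) : R := 2^-1 ^+ n.
have h0 n : 0 < h n by rewrite exprn_gt0// invr_gt0.
have hcvg : h @ \oo --> 0.
  by apply: cvg_expr; rewrite gtr0_norm ?invr_gt0// invf_lt1// ltr1n.
have hsmall T : 0 < T -> exists N : nat, forall n, (N <= n)%N -> h n <= T.
  by move=> T0; have [N _ hN] := cvgr_le _ hcvg _ T0; exists N.
have /choice[v hv] n : exists v, K v /\ euler b f (h n) v.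
  have [//|v Kv Ev] := @euler_exists b f b0 K (h n) (h0 n) Kcl Kf KD KZ.
    by move=> u; apply: KQ; exact: ltW.
  by exists v.
have /cvg_ex[l vl] : cvgn v.
  apply: cvgn_cauchy => e e0.
  have be0 : 0 < b * e / 2 by rewrite divr_gt0// mulr_gt0.
  have [T T0 hT] := semigroup_near0 f be0.
  have [N1 hN1] := hsmall _ T0.
  have c0 : 0 < 4 * `|f| + 1 by rewrite ltr_wpDl// mulr_ge0.
  have [N2 hN2] := hsmall _ (divr_gt0 e0 c0).
  exists (maxn N1 N2) => n m; rewrite geq_max => /andP[/hN1 n1 /hN2 n2] nm.
  have hnm : h n = (2 ^ (m - n))%:R * h m.
    by rewrite /h natrX -[X in _ * _ ^+ X](subnK nm) exprD mulrA -exprMn divff// expr1n mul1r.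
  have m2 : (0 < 2 ^ (m - n))%N by rewrite expn_gt0.
  have := @euler_dist b f b0 (h m) (v m) (v n) _ (b * e / 2) (h0 m) m2 (hv m).2.
  rewrite -hnm => /(_ (hv n).2) h1; rewrite distrC -(ler_pM2l b0).
  apply: le_trans (h1 _) _.
    by move=> s s0 sh; apply: hT => //; exact: le_trans n1.
  have : b * (h n * (4 * `|f| + 1)) <= b * e.
    by rewrite ler_pM2l// -ler_pdivlMr.
  have := mulr_ge0 (ltW b0) (ltW (h0 n)); lra.
exists l.
  apply: (@closed_cvg _ _ \oo _ v K) => //.
  by apply: nearW => n; case: (hv n).
set g := f - b *: l.
rewrite /generator /=; apply/cvgrPdist_le => e e0.
have [T T0 hT] := semigroup_near0 g e0.
exists T => // t /=; rewrite sub0r normrN => tT t0.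
rewrite gtr0_norm// in tT.
suff le : `|l - Q t l - t *: g| <= t * e.
  rewrite -(ler_pM2l t0) -{1}(gtr0_norm t0) -normrZ.
  rewrite (_ : _ *: _ = l - Q t l - t *: g)//.
  by have tn0 : t != 0 by [rewrite gt_eqF]; rewrite /g; vfield hip.
apply/ler_addgt0Pr => d d0.
have c0 : 0 < 4 + t * b by rewrite addr_gt0// mulr_gt0.
(* The error will split into four terms of size at most [x] and a drift excess of at most [t b x];
   together they make [d]. *)
pose x := d / (4 + t * b).
have x0 : 0 < x by rewrite divr_gt0.
have [S S0 hS] := semigroup_near0 l x0.
have [N1 hN1] := hsmall _ S0.
have g1 : 0 < `|g| + 1 by rewrite ltr_wpDl.
have [N2 hN2] := hsmall _ (divr_gt0 x0 g1).
have /cvgr_dist_le/(_ _ x0)[N3 _ hN3] := vl.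
pose n := maxn N1 (maxn N2 N3).
have n1 : h n <= S by apply: hN1; rewrite leq_maxl.
have n2 : h n * (`|g| + 1) <= x.
  by rewrite -ler_pdivlMr// hN2// /n maxnCA leq_maxl.
have n3 : `|l - v n| <= x by apply: hN3; rewrite /= /n maxnA leq_maxr.
(* The Euler estimates reach only multiples of [h n]. The last one before [t] is [s], and the
   remaining time, shorter than [h n], is absorbed by continuity at 0 and by the smallness of
   [h n |g|]. *)
pose m := Num.truncn (t / h n).
have /andP[] := truncn_itv (divr_ge0 (ltW t0) (ltW (h0 n))).
rewrite -/m ler_pdivlMr// ltr_pdivrMr// => m1; rewrite -natr1 mulrDl mul1r => m2.
set s := m%:R * h n in m1 m2.
have s0 : 0 <= s by rewrite mulr_ge0// ltW.
have drift : `|v n - Q s (v n) - s *: g| <= s * (b * x + e).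
  apply: euler_drift (ltW (h0 n)) (hv n).2 _ => k km.
  have kh0 : 0 <= k%:R * h n by rewrite mulr_ge0// ltW.
  rewrite (_ : _ - g = Q (k%:R * h n) (f - b *: v n - g) +
                       (Q (k%:R * h n) g - g)); last first.
    by rewrite [Q _ (_ - g)]linearB addrA subrK.
  apply: le_trans (ler_normD _ _) _; apply: lerD.
    apply: le_trans (Qle _ kh0) _.
    rewrite (_ : _ - g = b *: (l - v n)); last by rewrite /g; vring hip.
    by rewrite normrZ gtr0_norm// ler_pM2l.
  apply: hT => //; apply: le_trans (ltW tT); apply: le_trans m1.
  by rewrite ler_wpM2r ?(ltW (h0 n))// ler_nat ltnW.
have ts0 : 0 <= t - s by rewrite subr_ge0.
have tE : Q t l = Q s (Q (t - s) l) by rewrite -QD// addrC subrK.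
rewrite (_ : _ - _ - _ = (l - v n) - Q s (l - v n) - Q s (Q (t - s) l - l)
  - (t - s) *: g + (v n - Q s (v n) - s *: g)); last first.
  by rewrite tE [Q s (l - v n)]linearB [Q s (_ - l)]linearB; vring hip.
have A1 := Qle (l - v n) s0.
have A2 : `|Q s (Q (t - s) l - l)| <= x.
  by apply: le_trans (Qle _ s0) _; apply: hS => //; apply: le_trans n1; lra.
have A3 : `|(t - s) *: g| <= x.
  rewrite normrZ ger0_norm//; apply: le_trans n2; apply: ler_pM => //.
    by lra.
  by rewrite lerDl.
have A4 : s * (b * x + e) <= t * (b * x + e).
  by rewrite ler_wpM2r// addr_ge0 ?(ltW e0)// mulr_ge0 ?ltW.
have dE : d = 4 * x + t * b * x by rewrite -mulrDl /x mulrC divfK ?gt_eqF.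
apply: le_trans (ler_normD _ _) _; rewrite dE.
have := ler_normB (l - v n - Q s (l - v n) - Q s (Q (t - s) l - l)) ((t - s) *: g).
have := ler_normB (l - v n - Q s (l - v n)) (Q s (Q (t - s) l - l)).
have := ler_normB (l - v n) (Q s (l - v n)).
lra.
Qed.

End ContractionSemigroup.

(** * Completeness and order of L2 *)

Section L2Complete.
Context d (T : measurableType d) (R : realType) (mu : probability T R).
Local Notation L2 := (LspaceType2 mu).

Lemma Lp_repr_measurable (u : L2) : measurable_fun setT (Lp_repr u).
Proof. exact: mf_subproof. Qed.

Lemma L2_norm_sqr (u : L2) (h : T -> R) : measurable_fun setT h ->
  (Lp_repr u : T -> R) = h %[ae mu] ->
  (`|u| ^+ 2)%:E = (\int[mu]_x (h x ^+ 2)%:E)%E.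
Proof.
move=> mh uh; rewrite -L2dot_norm /L2dot /Rintegral fineK; last first.
  by apply: integrable_fin_num => //; exact: L2_integrableM.
have msqr (k : T -> R) : measurable_fun setT k ->
    measurable_fun setT (fun x => (k x ^+ 2)%:E).
  by move=> mk; apply/measurable_EFinP; exact: measurable_funX.
under eq_integral do rewrite -expr2.
apply: ae_eq_integral => //; [exact/msqr/Lp_repr_measurable|exact: msqr|].
by apply: filterS uh => x /[apply] ->.
Qed.

Lemma L2_class_exists (h : T -> R) : measurable_fun setT h ->
  (\int[mu]_x (h x ^+ 2)%:E < +oo)%E ->
  exists u : L2, (Lp_repr u : T -> R) = h %[ae mu].
Proof.
move=> mh hfin; suff hL : h \in Lfun mu 2%:E.
  by exists (Lp_class (Lfun_Sub (lee1n 2) hL)); exact: Lp_classK.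
rewrite inE; apply/andP; split; rewrite inE//= /finite_norm.
apply: (@lty_poweRy _ _ 2); first by rewrite pnatr_eq0.
rewrite poweR_Lnorm ?pnatr_eq0//.
under eq_integral.
  move=> x _; rewrite abse_EFin poweR_EFin powR_mulrn// -normrX ger0_norm ?sqr_ge0//.
  over.
by [].
Qed.

(** Integrate [y <= y^2 / (2 c) + c / 2] against a measure of total mass one. *)
Lemma L2_int_abs_le (u : L2) (c : R) : 0 < c -> `|u| <= c ->
  (\int[mu]_x `|Lp_repr u x|%:E <= c%:E)%E.
Proof.
move=> c0 uc.
pose k := (2 * c)^-1; have k0 : 0 <= k by rewrite invr_ge0 mulr_ge0 ?(ltW c0).
have mu2 := Lp_repr_measurable u.
have msq : measurable_fun setT (fun x => (Lp_repr u x ^+ 2)%:E).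
  by apply/measurable_EFinP; exact: measurable_funX.
apply: (@le_trans _ _ (\int[mu]_x (k%:E * (Lp_repr u x ^+ 2)%:E + (c / 2)%:E))%E).
  apply: ge0_le_integral => //.
  - by apply/measurable_EFinP; exact: measurableT_comp.
  - by apply: emeasurable_funD => //; exact: measurable_funeM.
  - move=> x _; rewrite -EFinM -EFinD lee_fin -real_normK ?num_real//.
    have := sqr_ge0 (`|Lp_repr u x| - c).
    move: `|Lp_repr u x| => y h.
    have -> : k * y ^+ 2 + c / 2 = y + (y - c) ^+ 2 * k.
      by rewrite /k; field; rewrite gt_eqF.
    by rewrite lerDl mulr_ge0.
rewrite ge0_integralD//; last 3 first.
- by move=> x _; rewrite -EFinM lee_fin mulr_ge0// sqr_ge0.
- exact: measurable_funeM.
- by move=> x _; rewrite lee_fin divr_ge0// ltW.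
rewrite ge0_integralZl_EFin//; last by move=> x _; rewrite lee_fin sqr_ge0.
rewrite integral_cst// [X in (_ + _ * X)%E](_ : _ = 1%E) ?mule1; last exact: probability_setT.
rewrite -(@L2_norm_sqr u (Lp_repr u))//; last exact: ae_eq_refl.
rewrite -EFinM -EFinD lee_fin.
have : `|u| ^+ 2 <= c ^+ 2 by rewrite lerXn2r ?nnegrE ?(ltW c0).
move=> uc2; have : k * `|u| ^+ 2 <= k * c ^+ 2 by rewrite ler_wpM2l.
have -> : k * c ^+ 2 = c / 2 by rewrite /k; field; rewrite gt_eqF.
lra.
Qed.

(** The Riesz-Fischer argument: the increments are summable in L1, hence absolutely summable almost
    everywhere, and Fatou's lemma upgrades the pointwise limit to a limit in norm. *)
Lemma L2_cvg_fast (u : L2^nat) :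
  (forall n, `|u n.+1 - u n| <= 2^-1 ^+ n) -> cvgn u.
Proof.
move=> hu; pose w n := Lp_repr (u n.+1 - u n) : T -> R.
pose f n := Lp_repr (u n) : T -> R.
have wf : {ae mu, forall x, forall n, w n x = f n.+1 x - f n x}.
  apply: ae_foralln => n; apply: filterS2 (Lp_reprD (u n.+1) (- u n)) (Lp_reprN (u n)).
  by move=> x /(_ I) h1 /(_ I) h2; rewrite /w h1; congr (_ + _); exact: h2.
have mw n : measurable_fun setT (fun x => `|w n x|%:E).
  by apply/measurable_EFinP; apply: measurableT_comp => //; exact: Lp_repr_measurable.
have wfin : {ae mu, forall x, (\sum_(0 <= n <oo) `|w n x|%:E \is a fin_num)%E}.
  have wint : mu.-integrable setT (fun x => \sum_(0 <= n <oo) `|w n x|%:E)%E.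
    apply/integrableP; split.
      by apply: ge0_emeasurable_sum => // n x _ _; rewrite lee_fin.
    under eq_integral.
      by move=> x _; rewrite gee0_abs; [over|apply: nneseries_ge0 => n _ _; rewrite lee_fin].
    rewrite integral_nneseries//.
    apply: (@le_lt_trans _ _ 2%:E); last exact: ltry.
    apply: lime_le.
      by apply: is_cvg_nneseries => n _ _; apply: integral_ge0.
    apply: nearW => n.
    apply: (@le_trans _ _ (2 - 2 * 2^-1 ^+ n)%:E); last first.
      by rewrite lee_fin gerBl mulr_ge0// exprn_ge0.
    elim: n => [|n IH]; first by rewrite big_geq// expr0 mulr1 subrr.
    rewrite big_nat_recr//=.
    have h2 : 0 < 2^-1 ^+ n :> R by rewrite exprn_gt0.
    apply: le_trans (leeD IH (L2_int_abs_le h2 (hu n))) _.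
    by rewrite -EFinD lee_fin exprS; lra.
  by apply: filterS (integrable_ae measurableT wint) => x; exact.
(* The upper limit is measurable on the whole space; where it is infinite [fine] gives 0, which
   happens only on a null set. *)
pose l x := fine (limn_esup (fun n => (f n x)%:E)).
have mfr n : measurable_fun setT (f n) by exact: Lp_repr_measurable.
have mf n : measurable_fun setT (fun x => (f n x)%:E) by exact/measurable_EFinP.
have ml : measurable_fun setT l.
  apply: (@measurableT_comp _ _ _ _ _ _ fine); first exact: fine_measurable.
  exact: measurable_fun_limn_esup.
have fl : {ae mu, forall x, (f n x) @[n --> \oo] --> l x}.
  apply: filterS2 wf wfin => x wx wxfin.
  have /cvg_ex[y fy] : cvgn (f ^~ x).
    have tel n : f n x = f 0%N x + series (fun n => w n x) n.
      rewrite (eq_sum_telescope (f ^~ x) n); congr (_ + _).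
      by apply: eq_bigr => k _; rewrite wx.
    rewrite (_ : f ^~ x = fun n => f 0%N x + series (fun n => w n x) n); last exact/funext.
    apply: is_cvgD; first exact: is_cvg_cst.
    apply: normed_cvg; apply: nondecreasing_is_cvgn.
      by apply: nondecreasing_series => n _ _; exact: normr_ge0.
    exists (fine (\sum_(0 <= n <oo) `|w n x|%:E)%E) => _ [n _ <-].
    rewrite -lee_fin fineK// /series /= -sumEFin.
    by apply: nneseries_lim_ge => k _ _; rewrite lee_fin.
  suff -> : l x = y by [].
  have /cvg_limn_einf_sup[_ e] : (fun n => (f n x)%:E) @ \oo --> y%:E.
    by apply: cvg_EFin => //; exact: nearW.
  by rewrite /l e.
have dist n m : `|u (n + m)%N - u n| <= 2 * 2^-1 ^+ n.
  apply: (@le_trans _ _ (2 * 2^-1 ^+ n - 2 * 2^-1 ^+ (n + m))); last first.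
    by rewrite gerBl mulr_ge0// exprn_ge0.
  elim: m => [|m IH]; first by rewrite addn0 !subrr normr0.
  rewrite addnS exprS -(subrK (u (n + m)%N) (u (n + m).+1)) -addrA.
  apply: le_trans (ler_normD _ _) _; apply: le_trans (lerD (hu _) IH) _; lra.
(* Fatou along [m]: the integral of the limit of [(f m - f n)^2] is at most the lower limit of
   [|u m - u n|^2]. *)
have key n : (\int[mu]_x ((l x - f n x) ^+ 2)%:E <= ((2 * 2^-1 ^+ n) ^+ 2)%:E)%E.
  pose F m x := ((f m x - f n x) ^+ 2)%:E.
  have mF m : measurable_fun setT (F m).
    apply/measurable_EFinP; apply: measurable_funX.
    exact: measurable_funB.
  have F0 m x : setT x -> (0 <= F m x)%E by rewrite lee_fin sqr_ge0.
  have le1 : (\int[mu]_x ((l x - f n x) ^+ 2)%:E <=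
              \int[mu]_x limn_einf (F ^~ x))%E.
    have -> // : (\int[mu]_x ((l x - f n x) ^+ 2)%:E =
              \int[mu]_x limn_einf (F ^~ x))%E.
    apply: ae_eq_integral => //.
    - apply/measurable_EFinP; apply: measurable_funX.
      exact: measurable_funB.
    - rewrite (_ : (fun _ => _) =
          fun x => (- limn_esup (-%E \o (F ^~ x)))%E); last first.
        by apply/funext => x; rewrite limn_esupN oppeK.
      apply: (@measurableT_comp _ _ _ _ _ _ (-%E)); first exact: oppe_measurable.
      apply: measurable_fun_limn_esup => m.
      by apply: measurableT_comp => //; exact: oppe_measurable.
    - apply: filterS fl => x fx _.
      have /cvg_limn_einf_sup[-> _] // : F ^~ x @ \oo --> ((l x - f n x) ^+ 2)%:E.
      apply: cvg_EFin; first by apply: nearW.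
      have h : (f m x - f n x) @[m --> \oo] --> l x - f n x.
        by apply: cvgB => //; exact: cvg_cst.
      rewrite expr2 (_ : fine \o _ =
        fun m => (f m x - f n x) * (f m x - f n x)); first exact: cvgM.
      by apply/funext => m /=; rewrite expr2.
  apply: le_trans le1 _; apply: le_trans (fatou _ _ _ _) _ => //.
  rewrite limn_einf_lim; apply: lime_le; first exact: is_cvg_einfs.
  exists n => // m /= nm.
  apply: (@le_trans _ _ (\int[mu]_x F m x)%E).
    by apply: ereal_inf_lbound; exists m => /=.
  rewrite -(@L2_norm_sqr (u m - u n)); last 2 first.
  - exact: measurable_funB.
  - apply: filterS2 (Lp_reprD (u m) (- u n)) (Lp_reprN (u n)).
    by move=> x /(_ I) h1 /(_ I) h2 _; rewrite h1; congr (_ + _); exact: h2.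
  rewrite lee_fin lerXn2r ?nnegrE ?mulr_ge0 ?exprn_ge0//.
  by rewrite -(subnKC nm); exact: dist.
have mlf n : measurable_fun setT (fun x => l x - f n x).
  exact: measurable_funB.
(* Square integrability is at hand for [l - f 0], so the limit is assembled as [v + u 0]. *)
have [v vE] := L2_class_exists (mlf 0%N) (le_lt_trans (key 0%N) (ltry _)).
apply/cvg_ex; exists (v + u 0%N).
apply: (@cvgn0_le _ _ _ _ (fun n => 2 * 2^-1 ^+ n)).
  rewrite -[0](mulr0 2); apply: cvgMr; apply: cvg_expr.
  by rewrite gtr0_norm// invf_lt1// ltr1n.
move=> n; rewrite -(@ler_pXn2r _ 2%N)// ?nnegrE ?mulr_ge0 ?exprn_ge0//.
rewrite -lee_fin; apply: le_trans (key n).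
rewrite -(@L2_norm_sqr (v + u 0%N - u n))//.
have vu : Lp_repr (v + u 0%N) = l %[ae mu].
  apply: filterS2 vE (Lp_reprD v (u 0%N)) => x /(_ I) h1 /(_ I) h2 _.
  by rewrite h2 -[l x](subrK (f 0%N x)) -h1.
apply: filterS3 vu (Lp_reprD (v + u 0%N) (- u n)) (Lp_reprN (u n)).
move=> x /(_ I) h1 /(_ I) h2 /(_ I) h3 _.
by rewrite h2; congr (_ + _); [exact: h1|exact: h3].
Qed.

(** Balls of radius [2^-(n+1)] belonging to the filter meet pairwise, so their centres form a fast
    Cauchy sequence whose limit the filter inherits. *)
Lemma L2_complete (F : set_system L2) : ProperFilter F -> cauchy F -> cvg F.
Proof.
move=> FF /cauchyP Fc.
pose r n : R := 2^-1 ^+ n.+1.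
have r0 n : 0 < r n by rewrite exprn_gt0.
have /choice[x Fx] n : exists y, F (ball y (r n)) by exact: Fc.
have /cvg_ex[l xl] : cvgn x.
  apply: L2_cvg_fast => n.
  have [y []] := filter_ex (filterI (Fx n) (Fx n.+1)).
  rewrite -!ball_normE /= => h1 h2.
  rewrite -(subrK y (x n.+1)) -addrA; apply: le_trans (ler_normD _ _) _.
  rewrite [X in _ + X]distrC; have := ltW h1; have := ltW h2.
  by rewrite /r !exprS; have : 0 < 2^-1 ^+ n :> R by [rewrite exprn_gt0]; lra.
apply/cvg_ex; exists l; apply/cvgrPdist_le => e e0.
have e2 : 0 < e / 2 by rewrite divr_gt0.
have /cvgr_dist_le/(_ _ e2)[N1 _ hN1] := xl.
have rcvg : r @ \oo --> 0.
  rewrite /r -[0](mulr0 2^-1); under eq_fun do rewrite exprS.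
  apply: cvgMr; apply: cvg_expr.
  by rewrite gtr0_norm// invf_lt1// ltr1n.
have [N2 _ hN2] := cvgr_le _ rcvg _ e2.
pose n := maxn N1 N2.
apply: filterS (Fx n) => y; rewrite -ball_normE /= => hy.
have := hN1 n (leq_maxl _ _); have := hN2 n (leq_maxr _ _) => /= a1 a2.
rewrite -(subrK (x n) l) -addrA; apply: le_trans (ler_normD _ _) _.
by have := ltW hy; lra.
Qed.

Lemma L2_nonnegD (u v : L2) : L2_nonneg u -> L2_nonneg v -> L2_nonneg (u + v).
Proof.
move=> u0 v0; apply: filterS3 u0 v0 (Lp_reprD u v) => x ux vx /(_ I) ->.
exact: addr_ge0.
Qed.

Lemma L2_nonnegZ a (u : L2) : 0 <= a -> L2_nonneg u -> L2_nonneg (a *: u).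
Proof.
move=> a0 u0; apply: filterS2 u0 (Lp_reprZ a u) => x ux /(_ I) ->.
exact: mulr_ge0.
Qed.

Lemma Lp_reprB (u v : L2) : Lp_repr (u - v) = Lp_repr u \- Lp_repr v %[ae mu].
Proof.
apply: filterS2 (Lp_reprD u (- v)) (Lp_reprN v) => x /(_ I) h1 /(_ I) h2 _.
by rewrite h1; congr (_ + _).
Qed.

Lemma K_aboveP (g u : L2) : K_above g u <-> L2_nonneg (u - g).
Proof.
by split=> h; apply: filterS2 h (Lp_reprB u g) => x hx /(_ I) e;
  move: hx; rewrite e subr_ge0.
Qed.

Lemma L2pos_nonneg (u : L2) : L2_nonneg (L2pos u).
Proof.
by apply: filterS (L2posE u) => x /(_ I) ->; rewrite le_max lexx orbT.
Qed.

Lemma L2pos_ge (u : L2) : L2_nonneg (L2pos u - u).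
Proof.
apply: filterS2 (L2posE u) (Lp_reprB (L2pos u) u) => x /(_ I) h /(_ I) ->.
by rewrite subr_ge0 h le_max lexx.
Qed.

(** Replacing the integrand by a version [h] that is nonnegative everywhere makes pointwise
    positivity of the integral applicable. *)
Lemma L2ip_ae (u v : L2) (h : T -> R) : measurable_fun setT h ->
  (forall x, 0 <= h x) ->
  (fun x => Lp_repr u x * Lp_repr v x) = h %[ae mu] -> 0 <= L2ip mu u v.
Proof.
move=> mh h0 uvh; rewrite [L2ip mu u v](_ : _ = \int[mu]_x h x).
  exact: Rintegral_ge0.
congr fine; apply: ae_eq_integral => //.
- exact: measurable_int (L2_integrableM _ _).
- exact/measurable_EFinP.
- by apply: filterS uvh => x /[apply] ->.
Qed.

Lemma L2ip_nonneg (u v : L2) : L2_nonneg u -> L2_nonneg v -> 0 <= L2ip mu u v.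
Proof.
move=> u0 v0; apply: (@L2ip_ae _ _ (fun x => `|Lp_repr u x| * `|Lp_repr v x|)).
- by apply: measurable_funM; apply: measurableT_comp => //; exact: Lp_repr_measurable.
- by move=> x; rewrite mulr_ge0.
- by apply: filterS2 u0 v0 => x ux vx _; rewrite !ger0_norm.
Qed.

Lemma L2pos_orth (u : L2) : L2ip mu (L2pos u) (L2pos u - u) <= 0.
Proof.
rewrite -oppr_ge0 -linearNr /=; apply: (@L2ip_ae _ _ (cst 0)) => //.
apply: filterS3 (L2posE u) (Lp_reprB (L2pos u) u) (Lp_reprN (L2pos u - u)).
move=> x /(_ I) h1 /(_ I) h2 /(_ I) h3 _; rewrite h3.
have -> : (\- Lp_repr (L2pos u - u)) x = - (Num.max (Lp_repr u x) 0 - Lp_repr u x).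
  by congr (- _); rewrite h2; congr (_ - _); exact: h1.
rewrite h1.
by case: (leP (Lp_repr u x) 0) => // _; rewrite ?subrr ?mul0r// oppr0 mulr0.
Qed.

End L2Complete.

(** * Cones with a monotone projection *)

Section Continuity.
Context {R : realType} {V : normedModType R}.

Lemma nonexpansive_continuous (F : V -> V) :
  (forall x y, `|F x - F y| <= `|x - y|) -> continuous F.
Proof.
move=> hF x; apply/cvgrPdist_le => e e0.
have /cvgr_dist_le/(_ _ e0) : id y @[y --> x] --> x by exact: cvg_id.
by apply: filterS => y; apply: le_trans; exact: hF.
Qed.

Lemma closed_sublevel (f : V -> R) c : continuous f -> closed [set u | f u <= c].
Proof.
by move=> fc; apply: (@closed_comp _ _ f [set x | x <= c]); [move=> *; exact: fc|exact: closed_le].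
Qed.

End Continuity.

(** An abstract form of the positive cone and positive part of L2, which keeps the obstacle problem
    free of almost-everywhere arguments. The axioms make [pos] the metric projection onto [L], with
    [u = pos u - (pos u - u)] as Moreau decomposition. *)
Definition cone_projection (R : realType) (V : normedModType R)
    (ip : {dot V for idfun}) (L : set V) (pos : V -> V) :=
  [/\ forall u v, L u -> L v -> L (u + v),
      forall a u, 0 <= a -> L u -> L (a *: u),
      forall u v, L u -> L v -> 0 <= ip u v,
      forall u, L (pos u) /\ L (pos u - u)
    & forall u, ip (pos u) (pos u - u) <= 0].

Section Cone.
Context {R : realType} {V : normedModType R} (ip : {dot V for idfun}).
Hypothesis hip : induces_norm ip.
Variables (L : set V) (pos : V -> V).
Hypothesis hL : cone_projection ip L pos.

(** With [n u = pos u - u], the gap between the two sides is the sum of the cross pairings of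
    [pos u] with [n v] and of [pos v] with [n u], minus the two diagonal ones, which are
    nonpositive. *)
Lemma pos_firm u v : `|pos u - pos v| ^+ 2 <= ip (u - v) (pos u - pos v).
Proof.
have [_ _ Lip Lpos posle] := hL.
have [pu qu] := Lpos u; have [pv qv] := Lpos v.
have := posle u; have := posle v.
have := Lip _ _ pu qv; have := Lip _ _ pv qu.
rewrite -hip !ipBE (ipC ip (pos v) (pos u)) (ipC ip v (pos u)) (ipC ip v (pos v)).
rewrite (ipC ip u (pos u)) (ipC ip u (pos v)); lra.
Qed.

Lemma pos_nonexpansive u v : `|pos u - pos v| <= `|u - v|.
Proof.
have := le_trans (pos_firm u v) (ip_le hip _ _).
rewrite expr2; have [->|n0] := eqVneq (pos u - pos v) 0; first by rewrite normr0.
by rewrite ler_pM2r ?normr_gt0.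
Qed.

Lemma pos_id u : L u -> pos u = u.
Proof.
move=> Lu; have [_ _ Lip Lpos posle] := hL; have [pu qu] := Lpos u.
apply/eqP; rewrite -subr_eq0 -normr_eq0 -sqrf_eq0 eq_le sqr_ge0 andbT -hip.
by have := posle u; have := Lip _ _ Lu qu; rewrite ipDl ipNl; lra.
Qed.

(** The cone is the fixed-point set of the nonexpansive map [pos]. *)
Lemma cone_closed : closed L.
Proof.
rewrite (_ : L = [set u | `|pos u - u| <= 0]).
  apply: closed_sublevel => u; apply: cvg_norm; apply: cvgB => //.
  by apply: nonexpansive_continuous; exact: pos_nonexpansive.
apply/seteqP; split=> u /=; first by move=> /pos_id ->; rewrite subrr normr0.
rewrite normr_le0 subr_eq0 => /eqP <-; have [_ _ _ Lpos _] := hL.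
by case: (Lpos u).
Qed.

(** Pairing with [pos u] gives [|pos u|^2 <= ip (pos u) u <= ip (pos u) v <= ip (pos u) (pos v)]. *)
Lemma pos_norm_le u v : L (v - u) -> `|pos u| <= `|pos v|.
Proof.
move=> uv; have [_ _ Lip Lpos posle] := hL.
have [pu _] := Lpos u; have [_ qv] := Lpos v.
have h : `|pos u| * `|pos u| <= `|pos u| * `|pos v|.
  apply: le_trans (ip_le hip _ _); rewrite -expr2 -hip.
  have := posle u; have := Lip _ _ pu uv; have := Lip _ _ pu qv.
  by rewrite !ipBE; lra.
have [->|n0] := eqVneq (pos u) 0; first by rewrite normr0.
by move: h; rewrite ler_pM2l ?normr_gt0.
Qed.

Lemma pos_normZ_le a u : 0 <= a -> `|pos (a *: u)| <= a * `|pos u|.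
Proof.
move=> a0; have [_ LZ _ Lpos _] := hL; have [pu qu] := Lpos u.
rewrite -[a in leRHS]ger0_norm// -normrZ -[in leRHS](pos_id (LZ _ _ a0 pu)).
by apply: pos_norm_le; rewrite -scalerBr; exact: LZ.
Qed.

Lemma pos_normZ a u : 0 < a -> a * `|pos u| <= `|pos (a *: u)|.
Proof.
move=> a0; rewrite -ler_pdivlMl//.
rewrite -[u in leLHS]scale1r -(mulVf (lt0r_neq0 a0)) -scalerA.
by apply: pos_normZ_le; rewrite invr_ge0 ltW.
Qed.

Lemma pos_normD u v : `|pos (u + v)| <= `|pos u| + `|v|.
Proof.
have := ler_normD (pos (u + v) - pos u) (pos u); rewrite subrK.
by have := pos_nonexpansive (u + v) u; rewrite [u + v]addrC addrK; lra.
Qed.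

(* [w + pos (g - w)] is the maximum of [g] and [w]. *)
Lemma max_nonexpansive g w x :
  `|(w + pos (g - w)) - (x + pos (g - x))| <= `|w - x|.
Proof.
rewrite -(@ler_pXn2r _ 2%N)// ?nnegrE//.
rewrite (_ : _ - _ = (pos (g - w) - pos (g - x)) - (g - w - (g - x)));
  last by vring hip.
rewrite (ip_normB hip) (ipC ip) -[in leRHS]normrN.
rewrite (_ : g - w - (g - x) = - (w - x)); last by vring hip.
have := pos_firm (g - w) (g - x).
rewrite (_ : g - w - (g - x) = - (w - x)); last by vring hip.
have := sqr_ge0 (`|pos (g - w) - pos (g - x)|); lra.
Qed.

End Cone.

(** * The obstacle problem for a linear monotone relation *)

Definition linear_relation (R : realType) (V : normedModType R) (B : operator V) :=
  forall a x x' y y', B x y -> B x' y' -> B (a *: x + x') (a *: y + y').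

Section VariationalInequality.
Context {R : realType} {V : completeNormedModType R} (ip : {dot V for idfun}).
Hypothesis hip : induces_norm ip.
Variables (L : set V) (pos : V -> V).
Hypothesis hL : cone_projection ip L pos.
Variable B : operator V.
Hypothesis Blin : linear_relation B.
Hypothesis Bmono : forall x y, B x y -> 0 <= ip y x.
Hypothesis Bres : forall b f, 0 < b ->
  exists v, B v (f - b *: v) /\ (L f -> L v).

Lemma relationB x x' y y' : B x y -> B x' y' -> B (x - x') (y - y').
Proof.
move=> h h'; have := Blin (- 1) h' h.
by rewrite !scaleN1r ![- _ + _]addrC.
Qed.

Lemma resolvent_nonexpansive b f f' v v' : 0 < b ->
  B v (f - b *: v) -> B v' (f' - b *: v') -> b * `|v - v'| <= `|f - f'|.
Proof.
move=> b0 h h'; have := Bmono (relationB h h').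
rewrite (_ : _ - (f' - _) = (f - f') - b *: (v - v')); last by vring hip.
rewrite ipDl ipNl ipZl hip subr_ge0 => h1.
have := le_trans h1 (ip_le hip _ _); rewrite expr2 mulrA.
have [->|n0] := eqVneq (v - v') 0; first by rewrite normr0 !mulr0 => _; exact: normr_ge0.
by rewrite ler_pM2r ?normr_gt0.
Qed.

Lemma resolvent_inj b f v v' : 0 < b ->
  B v (f - b *: v) -> B v' (f - b *: v') -> v = v'.
Proof.
move=> b0 h h'; have := resolvent_nonexpansive b0 h h'.
by rewrite subrr normr0 pmulr_rle0// normr_le0 subr_eq0 => /eqP.
Qed.

(* The obstacle problem with [B] replaced by its Yosida approximation
   [u |-> b (u - r)]; the last component bounds the multiplier [z] by comparing
   the resolvents of [u] and [g], as [u >= g] and the resolvent is positive. *)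
Lemma obstacle_yosida a b f g rg : 0 < a -> 0 < b -> B rg (b *: (g - rg)) ->
  exists u r z, [/\ L (u - g), (forall v, L (v - g) -> 0 <= ip z (u - v)),
    B r (b *: (u - r)), a *: u + b *: (u - r) + z = f
    & `|z| <= `|pos (a *: g - f + b *: (g - rg))| ].
Proof.
move=> a0 b0 hrg; have [LD LZ Lip Lpos posle] := hL.
have ab0 : 0 < a + b by rewrite addr_gt0.
have /choice[J hJ] u : exists r, B r (b *: u - b *: r).
  by have [r [hr _]] := Bres (b *: u) b0; exists r.
have Jne u v : `|J u - J v| <= `|u - v|.
  rewrite -(ler_pM2l b0); apply: le_trans (resolvent_nonexpansive b0 (hJ u) (hJ v)) _.
  by rewrite -scalerBr normrZ gtr0_norm.
(* [W u] solves the equation without multiplier for a frozen resolvent [J u], and [F u] is the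
   maximum of [g] and [W u]. *)
pose W u := (a + b)^-1 *: (f + b *: J u).
pose F u := W u + pos (g - W u).
have q0 : 0 <= b / (a + b) by rewrite divr_ge0 ?ltW.
have q1 : b / (a + b) < 1 by rewrite ltr_pdivrMr// mul1r ltrDr.
have [||x y|u _ Fu] := @contraction_fixpoint R V setT F _ q0 q1 closedT.
- by exists 0.
- by [].
- apply: le_trans (max_nonexpansive hip hL _ _ _) _.
  rewrite /W -scalerBr (_ : _ - _ = b *: (J x - J y)); last by vring hip.
  rewrite scalerA normrZ gtr0_norm ?mulr_gt0 ?invr_gt0// [_^-1 * _]mulrC.
  by rewrite ler_wpM2l.
set w := W u in Fu; set p := pos (g - w) in Fu.
have uE : F u = w + p by [].
have wE : (a + b) *: w = f + b *: J u.
  by rewrite /w scalerA divff ?gt_eqF// scale1r.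
have [pL dL] := Lpos (g - w).
have uL : L (u - g) by rewrite -Fu uE (_ : _ - _ = p - (g - w)) //; vring hip.
exists u, (J u), (- ((a + b) *: p)); split => //.
- move=> v vL; rewrite ipNl ipZl -mulrN mulr_ge0 ?(ltW ab0)// -ipNr -Fu uE.
  rewrite (_ : - (w + p - v) = (v - g) - (p - (g - w))); last by vring hip.
  by rewrite ipDr ipNr subr_ge0; apply: le_trans (posle _) (Lip _ _ pL vL).
- by rewrite scalerBr; exact: hJ.
- rewrite (_ : _ - _ = (a + b) *: w - b *: J u);
    last by rewrite -{1 2}Fu uE; vring hip.
  by rewrite wE addrK.
- rewrite normrN normrZ gtr0_norm//; apply: le_trans (pos_normZ hip hL _ ab0) _.
  (* It remains to see that [b (J u - rg)] is in the cone: by linearity [J u - rg] is the resolvent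
     of [b (u - g)], which is in the cone. *)
  apply: (pos_norm_le hip hL); rewrite [(a + b) *: _]scalerBr wE.
  rewrite (_ : _ - (_ - (f + _)) = b *: (J u - rg)); last by vring hip.
  apply: (LZ); first exact: ltW.
  have [v [hv vL]] := Bres (b *: (u - g)) b0.
  have -> : J u - rg = v.
    apply: resolvent_inj b0 _ hv; have := relationB (hJ u) hrg.
    by congr (B _); vring hip.
  by apply/vL/LZ => //; exact: ltW.
Qed.

Theorem obstacle_problem (g : V) (M : R) (b : R^nat) :
  (forall n, n.+1%:R <= b n) ->
  (forall n, exists2 r, B r (b n *: (g - r)) & `|pos (b n *: (g - r))| <= M) ->
  forall a f, 0 < a -> exists u y z, [/\ L (u - g), B u y,
    (forall v, L (v - g) -> 0 <= ip z (u - v)) & a *: u + y + z = f].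
Proof.
move=> bge hM a f a0.
have b0 n : 0 < b n by apply: lt_le_trans (bge n); rewrite ltr0n.
pose M1 := M + `|a *: g - f|.
have /choice[t ht] n : exists t : V * V * V, [/\ L (t.1.1 - g),
    (forall v, L (v - g) -> 0 <= ip t.2 (t.1.1 - v)),
    B t.1.2 (b n *: (t.1.1 - t.1.2)),
    a *: t.1.1 + b n *: (t.1.1 - t.1.2) + t.2 = f & `|t.2| <= M1].
  have [rg hrg rM] := hM n.
  have [u [r [z [h1 h2 h3 h4 h5]]]] := obstacle_yosida f a0 (b0 n) hrg.
  exists (u, r, z); split => //; apply: le_trans h5 _.
  by rewrite addrC; apply: le_trans (pos_normD hip hL _ _) _; rewrite /M1 lerD.
pose u n := (t n).1.1; pose r n := (t n).1.2; pose z n := (t n).2.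
pose y n := b n *: (u n - r n).
have uL n : L (u n - g) by case: (ht n).
have zK n v : L (v - g) -> 0 <= ip (z n) (u n - v) by case: (ht n) => _ + _ _ _; exact.
have By n : B (r n) (y n) by case: (ht n).
have eqn n : a *: u n + y n + z n = f by case: (ht n).
have zM n : `|z n| <= M1 by case: (ht n).
have urE n : u n - r n = (b n)^-1 *: y n.
  by rewrite /y scalerA mulVf ?gt_eqF// scale1r.
clearbody y z r u.
(* Pair the equation with [u n]; the Yosida term contributes [ip y r + |y|^2 / b >= 0]. *)
have uM n : a * `|u n| <= `|f| + M1.
  have h1 : 0 <= ip (y n) (u n).
    rewrite -(subrK (r n) (u n)) ipDr addr_ge0 ?(Bmono (By n))// urE ipZr hip.
    by rewrite mulr_ge0 ?sqr_ge0// invr_ge0 ltW.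
  have h2 : a * `|u n| * `|u n| <= (`|f| + M1) * `|u n|.
    rewrite -mulrA -expr2 -hip.
    apply: (@le_trans _ _ (ip (f - z n) (u n))).
      by rewrite -(eqn n) !ipE; lra.
    apply: le_trans (ip_le hip _ _) _; rewrite ler_wpM2r//.
    by apply: le_trans (ler_normB _ _) _; rewrite lerD2l.
  have [->|n0] := eqVneq (u n) 0.
    by rewrite normr0 mulr0 addr_ge0// (le_trans _ (zM n)).
  by move: h2; rewrite ler_pM2r ?normr_gt0.
pose M2 := 2 * (`|f| + M1).
have yM n : `|y n| <= M2.
  rewrite (_ : y n = f - a *: u n - z n); last by rewrite -(eqn n); vring hip.
  apply: le_trans (ler_normB _ _) _.
  have := ler_normB f (a *: u n); rewrite normrZ gtr0_norm//.
  by have := uM n; have := zM n; rewrite /M2; lra.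
have M20 : 0 <= M2 by apply: le_trans (yM 0%N).
clearbody M2.
have ibn n : (b n)^-1 <= n.+1%:R^-1 by rewrite lef_pV2 ?posrE ?b0 ?ltr0n.
have urM n : `|u n - r n| <= M2 * n.+1%:R^-1.
  rewrite urE normrZ gtr0_norm ?invr_gt0// mulrC.
  by apply: ler_pM => //; rewrite invr_ge0 ltW.
have /cvg_ex[l ul] : cvgn u.
  (* In the subtracted equations paired with [u n - u m], only the gaps [u - r] have the wrong sign:
     [|y n - y m| <= 2 M2] times a gap difference of at most [2 M2 / (n + 1)]. *)
  apply: (@cvgn_cauchy_sqr _ _ _ (fun n => 4 * M2 ^+ 2 / a * n.+1%:R^-1)).
    by rewrite -[0](mulr0 (4 * M2 ^+ 2 / a)); apply: cvgMr; exact: cvg_harmonic.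
  move=> n m nm.
  have ibm : m.+1%:R^-1 <= n.+1%:R^-1 :> R by rewrite lef_pV2 ?posrE ?ltr0n// ler_nat.
  have h4 := Bmono (relationB (By n) (By m)).
  have h5 := zK n _ (uL m); have h6 := zK m _ (uL n).
  have h1 k : `|(u k - r k)| <= M2 * k.+1%:R^-1 := urM k.
  have h2 : - (2 * M2 * (2 * M2 * n.+1%:R^-1)) <=
      ip (y n - y m) ((u n - r n) - (u m - r m)).
    apply: le_trans (ip_ge hip _ _); rewrite lerN2; apply: ler_pM => //.
      by apply: le_trans (ler_normB _ _) _; rewrite mulr_natl mulr2n lerD.
    apply: le_trans (ler_normB _ _) _; rewrite -mulrA mulr_natl mulr2n lerD//.
    by apply: le_trans (urM m) _; rewrite ler_wpM2l.
  have h3 : a * `|u n - u m| ^+ 2 =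
      - ip (z n) (u n - u m) - ip (z m) (u m - u n)
      - ip (y n - y m) (r n - r m)
      - ip (y n - y m) ((u n - r n) - (u m - r m)).
    have e : a *: (u n - u m) = - (y n - y m) - (z n - z m).
      apply/eqP; rewrite -subr_eq0 opprB addrA; apply/eqP.
      rewrite -(subrr f) -{1}(eqn n) -(eqn m); vring hip.
    by rewrite -hip -ipZl e !ipBE; ring.
  rewrite -(ler_pM2l a0) h3 mulrA (_ : a * _ = 4 * M2 ^+ 2); last first.
    by field; rewrite gt_eqF.
  move: h2 h4 h5 h6; rewrite expr2; move: (n.+1%:R^-1) => h.
  by lra.
have lL : L (l - g).
  have Lcl : closed L := cone_closed hip hL.
  apply: (@closed_cvg _ _ \oo _ (fun n => u n - g) L) => //; first exact: nearW.
  by apply: cvgB => //; exact: cvg_cst.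
(* The resolvent [J] of [B] at 1 encodes [B l y] as [J (l + y) = l], a condition stable under limits
   since [J] is nonexpansive. *)
have /choice[J hJ] v : exists x, B x (v - x).
  have [x [hx _]] := Bres v ltr01.
  by exists x; rewrite -[X in _ - X]scale1r.
have hJ1 v : B (J v) (v - 1 *: J v) by rewrite scale1r.
have Jne v w : `|J v - J w| <= `|v - w|.
  by have := resolvent_nonexpansive ltr01 (hJ1 v) (hJ1 w); rewrite mul1r.
have Jmid v w : J (2^-1 *: (v + w)) = 2^-1 *: (J v + J w).
  apply: resolvent_inj ltr01 (hJ1 _) _.
  have h := Blin 1 (hJ1 v) (hJ1 w).
  have h0 : B 0 0 by have := relationB (hJ v) (hJ v); rewrite !subrr.
  by have := Blin 2^-1 h h0; congr (B _); vring hip.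
pose p := l + f - a *: l.
(* The conditions on a multiplier [x] at [l], relaxed by [1 / (n + 1)]. Midpoints stay in [C n]
   because [J] preserves midpoints, and a point common to all [C n] is an exact multiplier. *)
pose C n := [set x | [/\ `|x| <= M1, `|J (p - x) - l| <= n.+1%:R^-1
  & forall v, L (v - g) -> - n.+1%:R^-1 <= ip x (l - v)]].
have [x hx] : exists x, forall n, C n x.
  apply: (@nested_convex_nonempty _ _ _ hip C M1).
  - move=> n; have M10 : 0 <= M1 by apply: le_trans (zM 0%N).
    have k0 : 0 < 4 + a + M1 by rewrite ltr_wpDr// addr_gt0.
    (* For [m] large [z m] lies in [C n]: the resolvent condition costs [4 e + a e], the variational
       inequality [M1 e]. *)
    pose e := n.+1%:R^-1 / (4 + a + M1).
    have e0 : 0 < e by rewrite divr_gt0// invr_gt0 ltr0n.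
    have eE : 4 * e + a * e + M1 * e = n.+1%:R^-1.
      by rewrite /e; move: (n.+1%:R^-1) => h; field; rewrite gt_eqF.
    have hcvg : (fun m => M2 * m.+1%:R^-1) @ \oo --> 0.
      by rewrite -[0](mulr0 M2); apply: cvgMr; exact: cvg_harmonic.
    have /cvgr_dist_le/(_ _ e0) near1 := ul.
    have [m [/= m1 m2]] := filter_ex (filterI near1 (cvgr_le _ hcvg _ e0)).
    have lr : `|l - r m| <= 2 * e.
      rewrite -(subrK (u m) l) -addrA; apply: le_trans (ler_normD _ _) _.
      by have := le_trans (urM m) m2; lra.
    exists (z m); split => //.
    + have rE : J (r m + y m) = r m.
        by apply: resolvent_inj ltr01 (hJ1 _) _; rewrite scale1r addrC addKr.
      have := Jne (p - z m) (r m + y m); rewrite rE.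
      rewrite (_ : p - _ - _ = (l - r m) - a *: (l - u m)); last first.
        by rewrite /p -(eqn m); vring hip.
      have := ler_normB (l - r m) (a *: (l - u m)); rewrite normrZ gtr0_norm//.
      have : a * `|l - u m| <= a * e by rewrite ler_pM2l.
      have := ler_normD (J (p - z m) - r m) (r m - l).
      rewrite addrA subrK (distrC (r m) l) -eE.
      by have := mulr_ge0 M10 (ltW e0); lra.
    + move=> v vL; rewrite (_ : l - v = (u m - v) + (l - u m)); last by vring hip.
      rewrite ipDr; have := zK m v vL; have := ip_ge hip (z m) (l - u m).
      have : `|z m| * `|l - u m| <= M1 * e by apply: ler_pM.
      by have := mulr_gt0 a0 e0; rewrite -eE; lra.
  - move=> n m nm x [h1 h2 h3].
    have inm : m.+1%:R^-1 <= n.+1%:R^-1 :> R by rewrite lef_pV2 ?posrE ?ltr0n// ler_nat.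
    split => //; first exact: le_trans inm.
    by move=> v vL; apply: le_trans (h3 _ vL); rewrite lerN2.
  - move=> n.
    rewrite (_ : C n = [set x | `|x| <= M1] `&`
      [set x | `|J (p - x) - l| <= n.+1%:R^-1] `&`
      \bigcap_(v in [set v | L (v - g)]) [set x | - ip x (l - v) <= n.+1%:R^-1]).
      apply: closedI; first apply: closedI.
      + by apply: closed_sublevel; exact: norm_continuous.
      + apply: closed_sublevel => w; apply: cvg_norm; apply: cvgB; last exact: cvg_cst.
        apply: (nonexpansive_continuous (F := fun w => J (p - w))) => v v'.
        apply: le_trans (Jne _ _) _; rewrite (_ : _ - _ = v' - v); last by vring hip.
        by rewrite distrC.
      + apply: closed_bigI => v vL; apply: closed_sublevel => w.
        by apply: cvgN; apply: (cvg_ipl hip); exact: cvg_id.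
    apply/seteqP; split=> [w [w1 w2 w3]|w [[w1 w2] w3]]; split => //.
    + by move=> v vL /=; rewrite lerNl; exact: w3.
    + by move=> v vL; rewrite lerNl; exact: w3.
  - move=> n v w [v1 v2 v3] [w1 w2 w3]; split.
    + rewrite normrZ gtr0_norm ?invr_gt0//.
      by have := ler_normD v w; lra.
    + rewrite (_ : p - _ = 2^-1 *: ((p - v) + (p - w))); last by vfield hip.
      rewrite Jmid (_ : _ - l = 2^-1 *: ((J (p - v) - l) + (J (p - w) - l)));
        last by vfield hip.
      rewrite normrZ gtr0_norm ?invr_gt0//.
      have := ler_normD (J (p - v) - l) (J (p - w) - l); move: v2 w2.
      by move: (n.+1%:R^-1) => h; lra.
    + move=> q qL; rewrite ipZl ipDl.
      by have := v3 q qL; have := w3 q qL; move: (n.+1%:R^-1) => h; lra.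
  - by move=> n v [].
have small (c : R) : (forall n, c <= n.+1%:R^-1) -> c <= 0.
  move=> hc; apply/ler_addgt0Pr => e e0; rewrite add0r.
  have [N _ hN] := cvgr_le _ cvg_harmonic _ e0.
  exact: le_trans (hc N) (hN N (leqnn N)).
have Jx : J (p - x) = l.
  apply/eqP; rewrite -subr_eq0 -normr_le0; apply: small => n.
  by case: (hx n).
exists l, (f - a *: l - x), x; split => //.
- by have := hJ (p - x); rewrite Jx; congr (B _); rewrite /p; vring hip.
- move=> v vL; rewrite -oppr_le0; apply: small => n.
  by rewrite lerNl; case: (hx n) => _ _; exact.
- by vring hip.
Qed.

End VariationalInequality.

(** * Rescaled generators and the obstacle operator *)

Section Generator.
Context {R : realType} {V : normedModType R}.

Lemma cvg_expR_quotient (c : R) :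
  h^-1 * (expR (c * h) - 1) @[h --> 0^'+] --> c.
Proof.
have dc : is_derive (0 : R) 1 (c \*: id) c.
  by apply: is_derive_eq; rewrite /GRing.scale /= mulr1.
have de : is_derive ((c \*: id) (0 : R)) 1 expR 1.
  by apply: is_derive_eq; rewrite /= scaler0 expR0.
have [dex dv] := is_derive1_comp de dc.
rewrite -[X in _ --> X](mul1r c) -dv; apply: cvg_dnbhs_at_right.
rewrite (_ : (fun h => _) = fun h => h^-1 *:
  (((expR \o (c \*: id)) \o shift 0) (h *: 1) - (expR \o (c \*: id)) 0)) //.
apply/funext => h; rewrite /= addr0 [c *: (h *: 1)]/GRing.scale /= scaler0 expR0.
by rewrite [h *: 1]/GRing.scale /= mulr1.
Qed.

Lemma cvg_expR_at0 (c : R) : expR (c * h) @[h --> 0^'+] --> (1 : R).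
Proof.
rewrite (_ : (1 : R) = expR (c * 0)); last by rewrite mulr0 expR0.
have h1 : c * h @[h --> 0^'+] --> c * 0.
  by apply: cvgMr; apply: cvg_at_right_filter; exact: cvg_id.
exact: (cvg_comp _ _ h1 (@continuous_expR R (c * 0))).
Qed.

(** The product rule at time 0 for the exponential factor and the orbit of [u]. *)
Lemma generator_rescale (P Q : R -> {linear V -> V}) (c : R) u z :
  (forall t, Q t u = expR (c * t) *: P t u) ->
  generator P u z -> P t u @[t --> 0^'+] --> u -> generator Q u (z + c *: u).
Proof.
move=> QP Pz Pu; rewrite /generator /=.
rewrite -[z]scale1r (_ : (fun h => _) = fun h => expR (c * h) *: (h^-1 *: (P h u - u))
   + (h^-1 * (expR (c * h) - 1)) *: u); last first.
  apply/funext => h; rewrite QP !scalerBr !scalerA mulrBr mulr1 scalerBl.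
  by rewrite addrA ![_ * h^-1]mulrC subrK.
apply: cvgD; first by apply: cvgZ => //; exact: cvg_expR_at0.
by apply: cvgZl; exact: cvg_expR_quotient.
Qed.

Lemma generator_linear (P : R -> {linear V -> V}) : linear_relation (generator P).
Proof.
move=> a x x' y y' hy hy'; rewrite /generator /=.
rewrite (_ : (fun h => _) = fun h =>
  a *: (h^-1 *: (P h x - x)) + h^-1 *: (P h x' - x')).
  by apply: cvgD => //; exact: cvgZr.
apply/funext => h; rewrite linearP opprD addrACA -scalerBr scalerDr !scalerA.
by rewrite [h^-1 * a]mulrC.
Qed.

Lemma generator_dissipative (ip : {dot V for idfun}) (P : R -> {linear V -> V}) x y :
  induces_norm ip -> (forall t u, 0 <= t -> `|P t u| <= `|u|) ->
  generator P x y -> ip y x <= 0.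
Proof.
move=> hip Ple hy.
apply: (@closed_cvg _ _ (0^'+) _ (fun h => ip (h^-1 *: (P h x - x)) x)
  (fun r => r <= 0)).
- exact: closed_le.
- near=> h; have h0 : 0 < h by near: h; exact: nbhs_right_gt.
  rewrite ipZl ipDl ipNl hip pmulr_rle0 ?invr_gt0// subr_le0.
  apply: le_trans (ip_le hip _ _) _; rewrite expr2 ler_wpM2r//.
  exact/Ple/ltW.
- exact: (cvg_ipl hip).
Unshelve. all: by end_near. Qed.

End Generator.

Section Obstacle.
Context {R : realType} {V : completeNormedModType R} (ip : {dot V for idfun}).
Hypothesis hip : induces_norm ip.
Variables (L : set V) (pos : V -> V).
Hypothesis hL : cone_projection ip L pos.
Variables (P : R -> {linear V -> V}) (N : operator V) (omega : R) (g : V) (C : R).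
Hypothesis hP : C0_semigroup P.
Hypothesis hN : op_scale (- 1) N = generator P.
Hypothesis hPomega : forall t u, 0 <= t -> `|P t u| <= expR (omega * t) * `|u|.
Hypothesis hPpos : forall t u, 0 <= t -> L u -> L (P t u).
Hypothesis hC : forall lam : R, yosida_range omega lam ->
  `|pos (yosida N lam g)| <= C.

Let Q (t : R) : {linear V -> V} := expR (- omega * t) \*: P t.
Let B : operator V := fun u => [set y | generator Q u (- y)].

Lemma generatorP u z : N u z <-> generator P u (- z).
Proof.
rewrite -hN; split=> [Nz|[w Nw]]; first by exists z => //; rewrite scaleN1r.
by rewrite scaleN1r => /oppr_inj <-.
Qed.

Let Qcvg u : Q t u @[t --> 0^'+] --> u.
Proof.
have [_ _ _ Pc] := hP; rewrite -[X in _ --> X]scale1r /Q /=.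
by apply: cvgZ => //; exact: cvg_expR_at0.
Qed.

Let hQ : C0_semigroup Q.
Proof.
have [Pcont P0 PD Pc] := hP; split=> [t t0 u|u|s t u s0 t0|//].
- by apply: cvgZr; exact: Pcont.
- by rewrite /Q /= mulr0 expR0 scale1r P0.
- by rewrite /Q /= PD// linearZ /= scalerA -expRD -mulrDr.
Qed.

Let Qle t u : 0 <= t -> `|Q t u| <= `|u|.
Proof.
move=> t0; rewrite /Q /= normrZ gtr0_norm ?expR_gt0// mulNr expRN.
by rewrite ler_pdivrMl ?expR_gt0// hPomega.
Qed.

Let BP u z : N u z <-> B u (z + omega *: u).
Proof.
have [_ _ _ Pc] := hP; rewrite generatorP /B /=; split=> h.
  rewrite (_ : - _ = - z + - omega *: u); last by vring hip.
  exact: (@generator_rescale _ _ P Q).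
rewrite (_ : - _ = - (z + omega *: u) + omega *: u); last by vring hip.
have e t : P t u = expR (omega * t) *: Q t u.
  by rewrite /Q /= scalerA -expRD -mulrDl subrr mul0r expR0 scale1r.
exact: generator_rescale e h (@Qcvg u).
Qed.

Let Blin : linear_relation B.
Proof.
move=> a x x' y y' hy hy'; rewrite /B /= opprD -scalerN.
exact: generator_linear.
Qed.

Let Bmono x y : B x y -> 0 <= ip y x.
Proof.
by move=> /(generator_dissipative hip Qle); rewrite ipNl oppr_le0.
Qed.

Let Bres b f : 0 < b -> exists v, B v (f - b *: v) /\ (L f -> L v).
Proof.
have [LD LZ _ _ _] := hL.
move=> b0; rewrite /B; have [Lf|nLf] := pselect (L f).
  have [|v Lv hv] := @resolvent_exists _ _ ip hip Q hQ Qle L b f b0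
      (cone_closed hip hL) Lf LD LZ.
    by move=> t u t0 Lu; apply: LZ; [exact: expR_ge0|exact: hPpos].
  by exists v; rewrite /= opprB.
have [//|//|//|v _ hv] := @resolvent_exists _ _ ip hip Q hQ Qle setT b f b0 closedT I.
by exists v; rewrite /= opprB.
Qed.

(* With [lam = 1 / (b + omega)], the resolvent of [B] at [b g] is [k r'], where
   [r'] is the resolvent of [N] at [g] and [k = b / (b + omega)], whence
   [b (g - k r') = k (N_lam g + omega r')]. *)
Let Bbound b : 2 * `|omega| < b ->
  exists2 r, B r (b *: (g - r)) &
    `|pos (b *: (g - r))| <= 2 * (C + `|omega| * (2 * `|g|)).
Proof.
move=> hb.
have o1 : omega <= `|omega| := ler_norm omega.
have o2 : - omega <= `|omega| by rewrite -normrN ler_norm.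
have o0 := normr_ge0 omega.
have b0 : 0 < b by lra.
have bo0 : 0 < b + omega by lra.
have bon0 : b + omega != 0 by rewrite gt_eqF.
pose lam := (b + omega)^-1.
have lam0 : 0 < lam by rewrite invr_gt0.
have hlam : yosida_range omega lam.
  by split => // om0; rewrite ltf_pV2 ?posrE//; lra.
pose S := op_inv (op_add (@op_id R V) (op_scale lam N)) g.
(* Since [resolvent] defaults to 0, a point of [S] is needed to know that its value solves the
   equation. *)
have [v0 Sv0] : S !=set0.
  have [v [hv _]] := Bres ((b + omega) *: g) b0.
  exists v, v => //; exists (g - v); last by rewrite addrC subrK.
  exists ((b + omega) *: (g - v)); last by rewrite scalerA mulVf// scale1r.
  by apply/BP; move: hv; congr (B _ _); vring hip.
have : S (resolvent N lam g) by rewrite /resolvent; exact: xgetI Sv0.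
have := hC hlam; rewrite /yosida; set r' := resolvent N lam g.
move=> hY [_ -> [_ [q Nq <-] qE]].
have qE' : q = (b + omega) *: (g - r').
  by rewrite -qE addrAC subrr add0r scalerA mulfV// scale1r.
have Br' : B r' ((b + omega) *: g - b *: r').
  by move/BP: Nq; rewrite qE'; congr (B _ _); vring hip.
have B0 : B 0 0 by have := relationB Blin Br' Br'; rewrite !subrr.
(* Comparison with the zero solution gives the factor [(b + omega) / b], below 2 because
   [b > 2 |omega|]. *)
have r'g : `|r'| <= 2 * `|g|.
  have B00 : B 0 (0 - b *: 0) by rewrite scaler0 subr0.
  have := resolvent_nonexpansive hip Blin Bmono b0 Br' B00.
  rewrite !subr0 normrZ gtr0_norm// => h; rewrite -(ler_pM2l b0).
  apply: le_trans h _.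
  by rewrite mulrA ler_wpM2r//; lra.
pose k := b / (b + omega).
have k0 : 0 < k by rewrite divr_gt0.
have k2 : k <= 2 by rewrite ler_pdivrMr//; lra.
exists (k *: r').
  have := @Blin k _ _ _ _ Br' B0; rewrite !addr0; congr (B _ _).
  by rewrite /k; vfield hip.
rewrite (_ : b *: _ = k *: (lam^-1 *: (g - r') + omega *: r')); last first.
  by rewrite /k /lam invrK; vfield hip.
apply: le_trans (pos_normZ_le hip hL _ (ltW k0)) _.
apply: ler_pM => //; first exact: ltW.
apply: le_trans (pos_normD hip hL _ _) _; apply: lerD => //.
by rewrite normrZ ler_wpM2l.
Qed.

Theorem obstacle_m_accretive :
  let A := op_add N (normal_cone ip [set u | L (u - g)]) in
  op_dom A = op_dom N `&` [set u | L (u - g)] /\ omega_m_accretive ip omega A.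
Proof.
move=> A; split.
  apply/seteqP; split=> [u [_ [y Ny [z [Ku _] _]]]|u [[y Ny] Ku]].
    by split => //; exists y.
  exists (y + 0); exists y => //; exists 0 => //; split => // v _.
  by rewrite ip0l.
move=> lam olam; split.
  move=> x1 x2 y1 y2 [_ [_ -> <-] [_ [n1 N1 [z1 [K1 Z1] <-]] <-]].
  move=> [_ [_ -> <-] [_ [n2 N2 [z2 [K2 Z2] <-]] <-]].
  have B1 : B x1 (n1 + omega *: x1) by apply/BP.
  have B2 : B x2 (n2 + omega *: x2) by apply/BP.
  have h3 := Bmono (relationB Blin B1 B2).
  have h1 := Z1 _ K2; have := Z2 _ K1; rewrite -[x2 - x1]opprB ipNr => h2.
  rewrite (_ : lam *: x1 + _ - _ = ((n1 + omega *: x1) - (n2 + omega *: x2))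
    + (z1 - z2) + (lam - omega) *: (x1 - x2)); last by vring hip.
  rewrite ipDl ipZl hip addr_ge0//; last by rewrite mulr_ge0 ?sqr_ge0// subr_ge0 ltW.
  by rewrite ipDl addr_ge0// ipDl ipNl; lra.
apply/seteqP; split=> // f _.
(* [I + lam I + N] equals [(1 + lam - omega) I + B]. *)
have a0 : 0 < 1 + lam - omega by lra.
(* The shift by [2 |omega|] meets the threshold of [Bbound]. *)
pose b (n : nat) := n.+1%:R + 2 * `|omega|.
have [||u [y [z [Lu By Kz e]]]] := @obstacle_problem _ _ ip hip L pos hL B Blin
    Bmono Bres g (2 * (C + `|omega| * (2 * `|g|))) b _ _ _ f a0.
- by move=> n; rewrite lerDl mulr_ge0.
- by move=> n; apply: Bbound; rewrite ltrDr ltr0n.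
exists u, u => //; exists (lam *: u + ((y - omega *: u) + z)).
  exists (lam *: u); first by exists u.
  exists (y - omega *: u + z) => //; exists (y - omega *: u).
    by apply/BP; rewrite subrK.
  by exists z.
by rewrite -e; vring hip.
Qed.

End Obstacle.

(** * The obstacle problem in L2 of a probability measure *)

Lemma L2_cone_projection d (T : measurableType d) (R : realType)
    (mu : probability T R) :
  cone_projection (L2ip mu) (@L2_nonneg d T R mu) (@L2pos d T R mu).
Proof.
split; [exact: L2_nonnegD|exact: L2_nonnegZ|exact: L2ip_nonneg| |exact: L2pos_orth].
by move=> u; split; [exact: L2pos_nonneg|exact: L2pos_ge].
Qed.

Unset Implicit Arguments.

Theorem theorem2p1 (R : realType)
  (H : completeNormedModType R) (ipH : {dot H for idfun})
  (hH : induces_norm ipH)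
  (mu : probability (g_sigma_algebraType (@open H)) R)
  (P : R -> {linear LspaceType2 mu -> LspaceType2 mu})
  (N : operator (LspaceType2 mu)) (omega : R) (g : LspaceType2 mu) (C : R)
  (hP : C0_semigroup P)
  (hN : op_scale (- 1) N = generator P)
  (hPomega : forall (t : R) (phi : LspaceType2 mu), 0 <= t ->
    `|P t phi| <= expR (omega * t) * `|phi|)
  (hPpos : positivity_preserving P)
  (hC : forall lam : R, yosida_range omega lam -> `|L2pos (yosida N lam g)| <= C) :
  let A := op_add N (normal_cone (L2ip mu) (K_above g)) in
  op_dom A = op_dom N `&` K_above g /\ omega_m_accretive (L2ip mu) omega A.
Proof.
pose W : normedModType R := LspaceType2 mu.
(* Completeness is attached to the existing normed structure, so that norm and convergence remain
   those of the hypotheses. *)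
pose m := Uniform_isComplete.Build (LspaceType2 mu) (@L2_complete _ _ R mu).
pose V : completeNormedModType R := HB.pack (NormedModule.sort W) m.
move=> A; rewrite /A (_ : K_above g = [set u | L2_nonneg (u - g)]); last first.
  by apply/seteqP; split=> u /K_aboveP.
exact: (@obstacle_m_accretive R V (L2ip mu) (@L2dot_norm _ _ _ mu) _ _
  (@L2_cone_projection _ _ R mu) P N omega g C hP hN hPomega hPpos hC).
Qed.
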